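(* Let $(M,Q)$ be a connected quaternionic manifold of dimension $4n\geq 8$ with twistor fibration $\pi:Z\to M$. The tangent vertical bundle $\Theta\to Z$ of $\pi$ has a canonical class of equivalent holomorphic structures, determined by the exact quaternionic connections of $(M,Q)$; that is, for any two exact quaternionic connections $D$ and $D'$ of $(M,Q)$, the holomorphic structures $\bar\partial^{D}$ and $\bar\partial^{D'}$ of $\Theta$ are equivalent.
   Context: A quaternionic structure on a manifold $M$ of dimension $4n\ge 8$ is a rank-3 subbundle $Q\subset\mathrm{End}(TM)$, locally generated by almost complex structures $J_1,J_2,J_3$ satisfying the quaternionic relations (an admissible basis), which is preserved by some torsion-free linear connection on $M$; any torsion-free linear connection preserving $Q$ is called a quaternionic connection. $Q$ carries the Euclidean metric $\langle\cdot,\cdot\rangle$ for which admissible bases are orthonormal; a quaternionic connection $D$ acts on $Q$ by $D_XA=[D_X,A]$ and preserves $\langle\cdot,\cdot\rangle$. $D$ is exact if there is a volume form on $M$ preserved by $D$ (exact quaternionic connections always exist); $D$ is self-dual if the curvature $F$ of the connection induced by $D$ on $\Lambda^{4n}(T^*M)$ is $Q$-hermitian, i.e. $F(JX,JY)=F(X,Y)$ for all $J\in Q$ with $J^2=-\mathrm{Id}$. Exact implies self-dual. The twistor space $Z$ is the unit sphere bundle of $Q$, with projection $\pi:Z\to M$ and fibers $Z_p$; for $J\in Z_p$, $T_JZ_p=J^\perp\subset Q_p$. A quaternionic connection splits $T_JZ$ into $T_JZ_p$ and a horizontal space $\mathrm{Hor}_J\cong T_pM$. The (integrable) complex structure $\mathcal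 J$ of $Z$ is $A\mapsto J\circ A$ on $T_JZ_p$ and $J$ on $\mathrm{Hor}_J\cong T_pM$; it does not depend on the choice of quaternionic connection. $\Theta\to Z$ is the complex line bundle with fiber $\Theta_J=T_JZ_p=J^\perp\subset Q_p$, $p=\pi(J)$, with complex structure $\mathcal J(A)=J\circ A$. $\Pi:\pi^*Q\to\Theta$ is the orthogonal projection. For a self-dual quaternionic connection $D$, the connection $\nabla:=\Pi\circ\pi^*D$ on $\Theta$ has $\mathcal J$-invariant curvature, and $\bar\partial^D_Us:=\frac12(\nabla_Us+\mathcal J\nabla_{\mathcal JU}s)$, $U\in TZ$, $s\in\Gamma(\Theta)$, is the corresponding holomorphic structure of $\Theta$. Two holomorphic structures of $\Theta$ are equivalent if they are conjugated by an element of the gauge group $C^\infty(Z,\mathbb C^* )$. *)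

(* Defs.v *)
From HB Require Import structures.
From mathcomp Require Import all_boot all_order all_algebra.
From mathcomp Require Import all_classical all_reals all_analysis.
From mathcomp.real_closed Require Import complex.

Set Implicit Arguments.
Unset Strict Implicit.
Unset Printing Implicit Defensive.

Import Order.TTheory GRing.Theory Num.Theory.
Import numFieldNormedType.Exports.

Local Open Scope classical_set_scope.
Local Open Scope ring_scope.

Section Smooth.
Variables (R : realType) (V W : normedModType R).

(* [U] is meant to be open and [V] finite-dimensional: the derivative of [f] is
   C^k iff all directional derivatives of [f] are. *)
Fixpoint Ck (k : nat) (U : set V) (f : V -> W) : Prop :=
  if k is k'.+1 then
    (forall x, U x -> differentiable f x) /\
    (forall v : V, Ck k' U (fun x => 'D_v f x))
  else forall x, U x -> {for x, continuous f}.

Definition smooth_on (U : set V) (f : V -> W) := forall k, Ck k U f.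

Definition smooth_near (x : V) (f : V -> W) :=
  exists2 U : set V, open_nbhs x U & smooth_on U f.

End Smooth.

(* An m-manifold, given by an atlas of charts [phi i : dom i -> R^m] with
   inverses [psi i].  [chart_at p] is a chart around [p], fixed once and for all;
   [phi i] and [psi i] are irrelevant outside [dom i] and [phi i @` dom i]. *)
Record manifold (R : realType) (m : nat) := Manifold {
  point :> topologicalType;
  chart : Type;
  dom : chart -> set point;
  phi : chart -> point -> 'cV[R]_m;
  psi : chart -> 'cV[R]_m -> point;
  chart_at : point -> chart;
  dom_open : forall i, open (dom i);
  img_open : forall i, open (phi i @` dom i);
  phiK : forall i p, dom i p -> psi i (phi i p) = p;
  phi_continuous : forall i p, dom i p -> {for p, continuous (phi i)};
  psi_continuous : forall i x, (phi i @` dom i) x -> {for x, continuous (psi i)};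
  transition_smooth : forall i j,
    smooth_on (phi i @` (dom i `&` dom j)) (phi j \o psi i);
  chart_at_dom : forall p, dom (chart_at p) p;
  manifold_hausdorff : hausdorff_space point;
  manifold_second_countable : @second_countable point }.

Arguments dom {R m} M i : rename.
Arguments phi {R m} M i p : rename.
Arguments psi {R m} M i x : rename.
Arguments chart_at {R m} M p : rename.

Section Manifold.
Variables (R : realType) (m : nat) (M : manifold R m).
Implicit Types (p q : M).

(* The tangent space T_pM is 'cV_m, through the coordinates of [chart_at M p],
   and End(T_pM) is 'M_m.  Near [p], objects on M are expressed in the single
   chart [chart_at M p] by means of the two mutually inverse Jacobian matrices
   below. *)
Definition jac (i j : chart M) (x : 'cV[R]_m) : 'M[R]_m :=
  \matrix_(a, b) ('D_(delta_mx b 0 : 'cV[R]_m) (phi M j \o psi M i) x) a 0.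

(* T_qM -> R^m, the coordinates in the chart at [p] *)
Definition to_coord p q : 'M[R]_m :=
  jac (chart_at M q) (chart_at M p) (phi M (chart_at M q) q).

(* R^m -> T_qM *)
Definition of_coord p q : 'M[R]_m :=
  jac (chart_at M p) (chart_at M q) (phi M (chart_at M p) q).

Definition end_coord p q (A : 'M[R]_m) : 'M[R]_m :=
  to_coord p q *m A *m of_coord p q.

Definition smooth_fun (W : normedModType R) p (f : M -> W) :=
  smooth_near (phi M (chart_at M p) p) (f \o psi M (chart_at M p)).

Definition smooth_vf p (Y : M -> 'cV[R]_m) :=
  smooth_fun p (fun q => to_coord p q *m Y q).

Definition smooth_end p (A : M -> 'M[R]_m) :=
  smooth_fun p (fun q => end_coord p q (A q)).

(* X(f), for X in T_pM *)
Definition dirder p (X : 'cV[R]_m) (f : M -> R) : R :=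
  'D_X (f \o psi M (chart_at M p)) (phi M (chart_at M p) p).

(* the j-th coordinate vector field of the chart at [p] *)
Definition coord_vf p (j : 'I_m) (q : M) : 'cV[R]_m :=
  of_coord p q *m delta_mx j 0.

(* [D p X Y] is the vector D_X Y of T_pM, for X in T_pM and a vector field Y
   smooth near p (the value is irrelevant for other Y).  As f in the Leibniz rule
   is only required to be smooth near p, D_X Y depends only on the germ of Y
   at p (take for f an indicator function). *)
Definition covariant_derivative :=
  forall p : M, 'cV[R]_m -> (M -> 'cV[R]_m) -> 'cV[R]_m.

Implicit Type D : covariant_derivative.

Record linear_connection D : Prop := LinearConnection {
  conn_linear : forall p a X X' Y, smooth_vf p Y ->
    D p (a *: X + X') Y = a *: D p X Y + D p X' Y;
  conn_add : forall p X Y Y', smooth_vf p Y -> smooth_vf p Y' ->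
    D p X (fun q => Y q + Y' q) = D p X Y + D p X Y';
  conn_leibniz : forall p X (f : M -> R) Y,
    smooth_fun p (f : M -> R^o) -> smooth_vf p Y ->
    D p X (fun q => f q *: Y q) = dirder p X f *: Y p + f p *: D p X Y;
  conn_smooth : forall p X Y, smooth_vf p X -> smooth_vf p Y ->
    smooth_vf p (fun q => D q (X q) Y) }.

(* D_X Y - D_Y X = [X, Y], tested on functions *)
Definition torsion_free D :=
  forall p X Y (f : M -> R),
    smooth_vf p X -> smooth_vf p Y -> smooth_fun p (f : M -> R^o) ->
    dirder p (D p (X p) Y - D p (Y p) X) f =
      dirder p (X p) (fun q => dirder q (Y q) f)
      - dirder p (Y p) (fun q => dirder q (X q) f).

(* D_X A = [D_X, A], a tensor, evaluated on the coordinate vector fields of the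
   chart at [p] *)
Definition cov_end D p (X : 'cV[R]_m) (A : M -> 'M[R]_m) : 'M[R]_m :=
  \matrix_(a, j) (D p X (fun q => A q *m coord_vf p j q)
                  - A p *m D p X (coord_vf p j)) a 0.

Definition admissible (J1 J2 J3 : 'M[R]_m) :=
  [/\ J1 *m J1 = (-1)%:M, J2 *m J2 = (-1)%:M, J3 *m J3 = (-1)%:M,
      J1 *m J2 = J3 & J2 *m J1 = - J3].

Definition preserves D (Q : M -> set 'M[R]_m) :=
  forall p X (A : M -> 'M[R]_m), smooth_end p A ->
    (\forall q \near p, Q q (A q)) -> Q p (cov_end D p X A).

(* the three sections of an admissible basis are automatically independent *)
Definition quaternionic_subbundle (Q : M -> set 'M[R]_m) :=
  forall p, exists J1 J2 J3 : M -> 'M[R]_m,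
    [/\ smooth_end p J1, smooth_end p J2, smooth_end p J3
      & \forall q \near p, admissible (J1 q) (J2 q) (J3 q) /\
          Q q = [set A | exists a b c : R,
                   A = a *: J1 q + b *: J2 q + c *: J3 q] ].

Definition quaternionic_connection (Q : M -> set 'M[R]_m) D :=
  [/\ linear_connection D, torsion_free D & preserves D Q].

Definition quaternionic_structure (Q : M -> set 'M[R]_m) :=
  quaternionic_subbundle Q /\ exists D, quaternionic_connection Q D.

(* Since Lambda^m (R^m)^* is spanned by the determinant, a form of top degree on M
   is a function [w], with
     omega_p(v_1, ..., v_m) = w p * det (v_1 | ... | v_m)
   for v_1, ..., v_m in T_pM = R^m. *)
Definition frame_mx (v : 'I_m -> 'cV[R]_m) : 'M[R]_m := \matrix_(a, b) v b a 0.

Definition top_form (w : M -> R) p (v : 'I_m -> 'cV[R]_m) : R :=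
  w p * \det (frame_mx v).

Definition volume_form (w : M -> R) :=
  (forall p, w p != 0) /\
  (forall p, smooth_fun p
     ((fun q => top_form w q (fun j => coord_vf p j q)) : M -> R^o)).

Definition preserves_form D (w : M -> R) :=
  forall p X (V : 'I_m -> M -> 'cV[R]_m), (forall j, smooth_vf p (V j)) ->
    dirder p X (fun q => top_form w q (fun j => V j q)) =
    \sum_j top_form w p (fun b => if b == j then D p X (V j) else V b p).

Definition exact_connection (Q : M -> set 'M[R]_m) D :=
  quaternionic_connection Q D /\
  exists2 w, volume_form w & preserves_form D w.

(* the metric of Q; see [qdot_admissible] *)
Definition qdot (A B : 'M[R]_m) : R := - \tr (A *m B) / m%:R.

(* Elements of the total space of End(TM) are pairs (p, A), with A in End(T_pM);
   the coordinates on it induced by the chart at [p] identify it near the fibre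
   over [p] with an open subset of 'cV_m * 'M_m.  The product topology of
   M * 'M_m is not used: it is not the topology of End(TM). *)
Definition End_TM : Type := (M * 'M[R]_m)%type.

Definition E_coord p (z : End_TM) : 'cV[R]_m * 'M[R]_m :=
  (phi M (chart_at M p) z.1, end_coord p z.1 z.2).

Definition E_point p (u : 'cV[R]_m * 'M[R]_m) : End_TM :=
  let q := psi M (chart_at M p) u.1 in (q, of_coord p q *m u.2 *m to_coord p q).

Definition smooth_E (W : normedModType R) (z : End_TM) (F : End_TM -> W) :=
  smooth_near (E_coord z.1 z) (F \o E_point z.1).

Variable Q : M -> set 'M[R]_m.

Implicit Type z : End_TM.

Definition twistor : set End_TM := [set z | Q z.1 z.2 /\ qdot z.2 z.2 = 1].

(* Z is an embedded submanifold of End(TM): functions on Z are smooth when they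
   extend locally to smooth functions on End(TM). Away from z the extension G is
   unconstrained, except for agreeing with F on Z. *)
Definition extends_at (W : normedModType R) z (F G : End_TM -> W) :=
  smooth_E z G /\ forall y, twistor y -> G y = F y.

Definition smooth_Z (W : normedModType R) z (F : End_TM -> W) :=
  exists G, extends_at z F G.

(* T_zZ: velocities at z of curves in Z, in the coordinates at z *)
Definition tangent_Z z : set ('cV[R]_m * 'M[R]_m) :=
  [set u | exists c : R -> End_TM,
     [/\ c 0 = z,
         \forall t \near (0 : R), twistor (c t) /\ dom M (chart_at M z.1) (c t).1,
         smooth_near (0 : R^o) (fun t : R^o => E_coord z.1 (c t))
       & 'D_(1 : R^o) (fun t : R^o => E_coord z.1 (c t)) 0 = u] ].

(* dF_z(u), for u in T_zZ, by means of any local extension of F *)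
Definition d_Z (W : normedModType R) z (F : End_TM -> W)
    (u : 'cV[R]_m * 'M[R]_m) : W :=
  'D_u ((xget F [set G | extends_at z F G]) \o E_point z.1) (E_coord z.1 z).

Definition Theta z : set 'M[R]_m := [set A | Q z.1 A /\ qdot z.2 A = 0].

Definition Theta_section (s : End_TM -> 'M[R]_m) :=
  forall z, twistor z ->
    Theta z (s z) /\ smooth_Z z (fun y => end_coord z.1 y.1 (s y)).

(* the orthogonal projection onto the orthogonal of z.2 *)
Definition proj_Theta z (A : 'M[R]_m) : 'M[R]_m := A - qdot z.2 A *: z.2.

(* the matrix of connection forms of D at p, in the chart at p *)
Definition christoffel D p (X : 'cV[R]_m) : 'M[R]_m :=
  \matrix_(a, j) (D p X (coord_vf p j)) a 0.

(* If A has value [A0] at p, and derivative [A'] along X in the coordinates at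
   p, this is D_X A = A' + [Gamma(X), A0]. *)
Definition cov_coord D p (X : 'cV[R]_m) (A0 A' : 'M[R]_m) : 'M[R]_m :=
  A' + (christoffel D p X *m A0 - A0 *m christoffel D p X).

(* (pi^* D)_u s, where u.1 = d pi (u) *)
Definition pullback_conn D (s : End_TM -> 'M[R]_m) z
    (u : 'cV[R]_m * 'M[R]_m) : 'M[R]_m :=
  cov_coord D z.1 u.1 (s z) (d_Z z (fun y => end_coord z.1 y.1 (s y)) u).

Definition nabla_Theta D (s : End_TM -> 'M[R]_m) z
    (u : 'cV[R]_m * 'M[R]_m) : 'M[R]_m :=
  proj_Theta z (pullback_conn D s z u).

(* The component in T_z Z_p of u with respect to the splitting defined by D: for
   the velocity u of a curve (p(t), J(t)), this is the covariant derivative of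
   J(t) along p(t).  The component of u in Hor_z = T_pM is u.1. *)
Definition vertical D z (u : 'cV[R]_m * 'M[R]_m) : 'M[R]_m :=
  cov_coord D z.1 u.1 z.2 u.2.

(* the tangent vector at z with components (X, A) in that splitting *)
Definition of_split D z (X : 'cV[R]_m) (A : 'M[R]_m) : 'cV[R]_m * 'M[R]_m :=
  (X, A - (christoffel D z.1 X *m z.2 - z.2 *m christoffel D z.1 X)).

Definition cplx_Z D z (u : 'cV[R]_m * 'M[R]_m) : 'cV[R]_m * 'M[R]_m :=
  of_split D z (z.2 *m u.1) (z.2 *m vertical D z u).

Definition dbar D (s : End_TM -> 'M[R]_m) z
    (u : 'cV[R]_m * 'M[R]_m) : 'M[R]_m :=
  2^-1 *: (nabla_Theta D s z u + z.2 *m nabla_Theta D s z (cplx_Z D z u)).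

Definition gauge (g : End_TM -> R[i]) :=
  forall z, twistor z ->
    [/\ g z != 0, smooth_Z z ((fun y => complex.Re (g y)) : End_TM -> R^o)
      & smooth_Z z ((fun y => complex.Im (g y)) : End_TM -> R^o)].

(* multiplication by complex scalars in the fibre Theta_z *)
Definition cscale z (a : R[i]) (A : 'M[R]_m) : 'M[R]_m :=
  complex.Re a *: A + complex.Im a *: (z.2 *m A).

(* del' = g o del o g^-1 *)
Definition equivalent_structures
    (del del' : (End_TM -> 'M[R]_m) -> End_TM -> 'cV[R]_m * 'M[R]_m -> 'M[R]_m) :=
  exists2 g, gauge g &
    forall s, Theta_section s -> forall z, twistor z ->
    forall u, tangent_Z z u ->
      del' s z u = cscale z (g z) (del (fun y => cscale y (g y)^-1 (s y)) z u).

End Manifold.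

Lemma qdot_admissible (R : realType) (m : nat) (J1 J2 J3 : 'M[R]_m) :
  (0 < m)%N -> admissible J1 J2 J3 ->
  [/\ qdot J1 J1 = 1, qdot J2 J2 = 1 & qdot J3 J3 = 1] /\
  [/\ qdot J1 J2 = 0, qdot J1 J3 = 0 & qdot J2 J3 = 0].
Proof.
move=> m0 [h1 h2 h3 h12 h21].
have mN0 : m%:R != 0 :> R by rewrite pnatr_eq0 -lt0n.
have hs (J : 'M[R]_m) : J *m J = (-1)%:M -> qdot J J = 1.
  by move=> hJ; rewrite /qdot hJ mxtrace_scalar mulNrn opprK divff.
have hN (x : R) : x = - x -> x = 0.
  by move/eqP; rewrite -subr_eq0 opprK -mulr2n mulrn_eq0 => /eqP.
have h13 : J1 *m J3 = - J2 by rewrite -h12 mulmxA h1 mul_scalar_mx scaleN1r.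
have h31 : J3 *m J1 = J2.
  by rewrite -h12 -mulmxA h21 mulmxN h13 opprK.
have h23 : J2 *m J3 = J1.
  by rewrite -[J3]opprK -h21 mulmxN mulmxA h2 mul_scalar_mx scaleN1r opprK.
have h32 : J3 *m J2 = - J1.
  by rewrite -h12 -mulmxA h2 mul_mx_scalar scaleN1r.
have tr0 (A B C : 'M[R]_m) : A *m B = C -> B *m A = - C -> qdot A B = 0.
  move=> hAB hBA; rewrite /qdot (_ : \tr _ = 0) ?oppr0 ?mul0r //.
  by apply: hN; rewrite {1}mxtrace_mulC hBA hAB raddfN.
split; split; [exact: hs.. | exact: tr0 h12 h21 | | exact: tr0 h23 h32].
by apply: tr0 h13 _; rewrite h31 opprK.
Qed.

(* Main.v *)
From HB Require Import structures.
Require Import Defs.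
From mathcomp Require Import all_boot all_order all_algebra.
From mathcomp Require Import all_classical all_reals all_analysis.
From mathcomp.real_closed Require Import complex.
From mathcomp Require Import ring lra.

Set Implicit Arguments.
Unset Strict Implicit.
Unset Printing Implicit Defensive.

Import Order.TTheory GRing.Theory Num.Theory.
Import numFieldNormedType.Exports.

Local Open Scope classical_set_scope.
Local Open Scope ring_scope.

(** Two quaternionic connections differ by a symmetric tensor [S] such that
    every [S_X] normalizes [Q]. Such a tensor acts on [Q] through the 1-form
    [al = tr S / (4 (n + 1))], namely by [- sum_i al (J_i X) [J_i, .]]. Projecting
    to the orthogonal of [J] gives [nabla'_U = nabla_U - 2 al (J U) J], where [U]
    is projected to [M], while the complex structure of [Z] is unchanged; hence
    [dbar' = dbar - (al (U) + al (J U) J)]. If the connections preserve volume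
    forms [w] and [w'], then [tr S = d log |w' / w|], so [2 al = dh] with
    [h = log |w' / w| / (2 (n + 1))], and [exp h] conjugates [dbar] to [dbar']. *)

(** * Calculus of smooth maps *)

(** In an admissible basis, the commutator on [Q] is twice the cross product of R^3. The algebra
    therefore reduces to vector identities for P_X = sum_i al (J_i X) J_i, whose scalar product with
    J is al (J X). The constant 4 (n + 1) = m + 4 is an eigenvalue of a linear system satisfied by
    the components of S_X along [Q]; the other eigenvalue, m - 2, is nonzero.

    The two operators differ by -1/2 times the form dh (U) + dh (J U) J, the (0,1)-part of the
    differential of a real function. This is why a gauge with positive real values suffices, and h
    is given by a global formula.

    The analytic obstacle is that a section is differentiated along Z through an extension to
    End(TM), which gives a well-defined result only on velocities of curves in Z, while [dbar] also
    evaluates it at J U. That J U is such a velocity takes two steps: the vertical part of a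
    velocity lies in Theta, and every pair of a horizontal vector and an element of Theta is the
    velocity of an explicit curve. *)

Section DerivativeCalculus.
Variables (R : realType).
Implicit Types (V W : normedModType R).

Lemma linear_diff V W (l : V -> W) (x : V) : linear l -> continuous l ->
  is_diff x l l.
Proof.
move=> llin lc.
pose lM := GRing.isLinear.Build _ _ _ _ _ llin.
pose L : {linear _ -> _} := HB.pack l lM.
have lL : continuous L by [].
have lE : l = L by [].
rewrite lE; apply: DiffDef; first exact: linear_differentiable.
exact: diff_lin.
Qed.

(** On matrices continuity is automatic, [l] being a finite sum of coordinates times fixed vectors;
    only linearity has to be checked in later uses. *)
Lemma linear_mx_continuous m n W (l : 'M[R]_(m, n) -> W) :
  linear l -> continuous l.
Proof.
move=> llin.
pose lM := GRing.isLinear.Build _ _ _ _ _ llin.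
pose L : {linear _ -> _} := HB.pack l lM.
have lE (A : 'M[R]_(m, n)) : l A = \sum_i \sum_j A i j *: l (delta_mx i j).
  rewrite -[l]/(L : _ -> _) [in LHS](matrix_sum_delta A) linear_sum.
  by under eq_bigr => i _ do
    (rewrite linear_sum; under eq_bigr => j _ do rewrite linearZ).
rewrite (funext lE) => A.
apply: differentiable_continuous.
rewrite (_ : (fun B : 'M[R]_(m, n) => _)
  = \sum_i (fun B : 'M[R]_(m, n) => \sum_j B i j *: l (delta_mx i j))).
  apply: differentiable_sum => i.
  rewrite (_ : (fun B : 'M[R]_(m, n) => _)
    = \sum_j (fun B : 'M[R]_(m, n) => B i j *: l (delta_mx i j))).
    apply: differentiable_sum => j; apply: differentiableZl.
    exact: differentiable_coord.
  by apply/funext => B; rewrite fct_sumE.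
by apply/funext => B; rewrite fct_sumE.
Qed.

Lemma derive_comp (U V W : normedModType R) (f : U -> V) (g : V -> W) x v :
  differentiable f x -> differentiable g (f x) ->
  'D_v (g \o f) x = 'D_('D_v f x) g (f x).
Proof.
move=> df dg; rewrite !deriveE//; last exact: differentiable_comp.
by rewrite diff_comp.
Qed.

Lemma derive_linear_comp (U V W : normedModType R) (f : U -> V) (l : V -> W) x v :
  linear l -> continuous l -> differentiable f x ->
  'D_v (fun y => l (f y)) x = l ('D_v f x).
Proof.
move=> llin lc df; have ldiff := linear_diff (f x) llin lc.
by rewrite (@derive_comp _ _ _ f l)// deriveE// diff_val.
Qed.

Lemma fst_linear V W : linear (fst : V * W -> V).
Proof. by []. Qed.

Lemma snd_linear V W : linear (snd : V * W -> W).
Proof. by []. Qed.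

Lemma fst_continuous V W : continuous (fst : V * W -> V).
Proof. by move=> x; exact: cvg_fst. Qed.

Lemma snd_continuous V W : continuous (snd : V * W -> W).
Proof. by move=> x; exact: cvg_snd. Qed.

Lemma derive_fst (U V W : normedModType R) (f : U -> V * W) x v :
  differentiable f x -> 'D_v (fun y => (f y).1) x = ('D_v f x).1.
Proof. exact/derive_linear_comp/fst_continuous/fst_linear. Qed.

Lemma derive_snd (U V W : normedModType R) (f : U -> V * W) x v :
  differentiable f x -> 'D_v (fun y => (f y).2) x = ('D_v f x).2.
Proof. exact/derive_linear_comp/snd_continuous/snd_linear. Qed.

Lemma deriveZr V W (f : V -> W) x a v : differentiable f x ->
  'D_(a *: v) f x = a *: 'D_v f x.
Proof. by move=> df; rewrite !deriveE// linearZ. Qed.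

Lemma scaler_is_bilinear W :
  bilinear_for
    (GRing.Scale.Law.clone _ _ *:%R _) (GRing.Scale.Law.clone _ _ *:%R _)
    ( *:%R : R^o -> W -> W).
Proof.
split=> [u'|u] a x y /=.
- by rewrite scalerDl scalerA.
- by rewrite scalerDr !scalerA mulrC.
Qed.

Lemma diff_scale_mul V W (f : V -> R^o) (g : V -> W) x :
  differentiable f x -> differentiable g x ->
  is_diff x (fun y => f y *: g y)
    (fun v => f x *: 'd g x v + ('d f x v : R^o) *: g x).
Proof.
move=> df dg.
pose bM := bilinear_isBilinear.Build R R^o W W _ _ ( *:%R : R^o -> W -> W)
  (scaler_is_bilinear W).
pose b : {bilinear R^o -> W -> W} := HB.pack ( *:%R : R^o -> W -> W) bM.
have bc : continuous (fun p : R^o * W => b p.1 p.2).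
  by move=> p; exact: scale_continuous.
pose h y : R^o * W := (f y, g y).
have dh : differentiable h x by exact: differentiable_pair.
rewrite (_ : (fun y => f y *: g y) = (fun p => b p.1 p.2) \o h)//.
have db := differentiable_bilin (h x) bc.
apply: DiffDef; first exact: differentiable_comp.
rewrite diff_comp// diff_bilin// diff_pair//.
Qed.

Lemma differentiable_scale V W (f : V -> R^o) (g : V -> W) x :
  differentiable f x -> differentiable g x ->
  differentiable (fun y => f y *: g y) x.
Proof. by move=> df dg; have [] := diff_scale_mul df dg. Qed.

Lemma derive_scale V W (f : V -> R^o) (g : V -> W) x v :
  differentiable f x -> differentiable g x ->
  'D_v (fun y => f y *: g y) x = 'D_v f x *: g x + f x *: 'D_v g x.
Proof.
move=> df dg; have dfg := diff_scale_mul df dg.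
rewrite (deriveE _ df) (deriveE _ dg) deriveE; last exact: differentiable_scale.
by rewrite diff_val addrC.
Qed.

Lemma derive_comp1 V (f : V -> R^o) (phi : R -> R) (d : R) x v :
  differentiable f x -> is_derive (f x) 1 phi d ->
  differentiable (phi \o f : V -> R^o) x /\
  'D_v (phi \o f : V -> R^o) x = d * 'D_v f x.
Proof.
move=> df [dphi dE].
have dp : differentiable (phi : R^o -> R^o) (f x : R^o) by apply/derivable1_diffP.
split; first exact: (@differentiable_comp _ _ _ _ f (phi : R^o -> R^o)).
rewrite (@derive_comp _ _ _ f (phi : R^o -> R^o))//.
rewrite -[X in 'D_X _ _](@mulr1 R) (deriveZr _ _ dp).
by rewrite -dE mulrC.
Qed.

End DerivativeCalculus.

Section CkCalculus.
Variables (R : realType).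
Implicit Types (V W : normedModType R).

Lemma open_near (T : topologicalType) (U : set T) (P : T -> Prop) x :
  open U -> U x -> (forall y, U y -> P y) -> \forall y \near x, P y.
Proof.
move=> Uo Ux UP; near=> y; apply: UP; near: y.
by apply: open_nbhs_nbhs; split.
Unshelve. all: by end_near. Qed.

(** Differentiability is local: [g - f] vanishes near [x], so it is its value plus the zero linear
    map plus [o(id)], hence differentiable. *)
Lemma near_eq_differentiable V W (f g : V -> W) x :
  (\forall y \near x, f y = g y) -> differentiable f x -> differentiable g x.
Proof.
move=> fg df; pose e := g - f.
have -> : g = f + e by rewrite /e addrC subrK.
apply: differentiableD => //.
have e0 : \forall y \near x, e y = 0.
  by near=> y; rewrite /e -[LHS]/(g y - f y) -(near fg y)// subrr.
have ex0 : e x = 0 by exact: nbhs_singleton e0.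
have zlin : linear (fun _ : V => 0 : W).
  by move=> a u v; rewrite scaler0 addr0.
pose zM := GRing.isLinear.Build _ _ _ _ _ zlin.
pose z : {linear V -> W} := HB.pack (fun _ : V => 0 : W) zM.
have c0 : continuous z by move=> y; exact: cst_continuous.
have eo : e \o shift x = cst (e x) + z +o_ 0 id.
  apply/eqaddoP => _/posnumP[eps]; near=> y.
  rewrite !fctE /= ex0 !addr0 subr0.
  suff -> : e (y + x) = 0 by rewrite normr0 mulr_ge0.
  near: y; move: e0; rewrite (near_shift 0).
  by apply: filterS => y; rewrite /= subr0.
have dE := diff_unique c0 eo.
by apply/diff_locallyP; rewrite dE.
Unshelve. all: by end_near. Qed.

Lemma CkW V W k (U : set V) (f : V -> W) : Ck k.+1 U f -> Ck k U f.
Proof.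
elim: k f => [|k IH] f /= [df Df].
  by move=> x /df /differentiable_continuous.
by split => // v; apply: IH.
Qed.

Lemma Ck_sub V W k (U U' : set V) (f : V -> W) :
  U' `<=` U -> Ck k U f -> Ck k U' f.
Proof.
move=> UU'; elim: k f => [|k IH] f /=; first by move=> fc x /UU' /fc.
by move=> [df Df]; split=> [x /UU' /df//|v]; exact: IH.
Qed.

(** Because [U] is open, agreement on [U] is agreement of germs at each of its points, so
    directional derivatives agree on [U] too and the induction goes through. The rules below use
    this to replace a derivative by a formula that is valid on [U] only. *)
Lemma eq_Ck V W k (U : set V) (f g : V -> W) : open U ->
  (forall x, U x -> f x = g x) -> Ck k U f -> Ck k U g.
Proof.
move=> Uo; elim: k f g => [|k IH] f g fg /=.
  move=> fc x Ux; rewrite /prop_for /continuous_at -(fg x Ux).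
  apply: cvg_trans (fc x Ux); apply: near_eq_cvg.
  exact: open_near Uo Ux fg.
move=> [df Df]; split=> [x Ux|v].
  by apply: near_eq_differentiable (df x Ux); exact: open_near Uo Ux fg.
apply: IH (Df v) => x Ux; apply: near_eq_derive.
exact: open_near Uo Ux fg.
Qed.

Lemma Ck_cst V W k (U : set V) (a : W) : Ck k U (fun _ : V => a).
Proof.
elim: k a => [|k IH] a /=; first by move=> x _; exact: cst_continuous.
split=> [x _|v]; first exact: differentiable_cst.
suff -> : 'D_v (fun _ : V => a) = fun=> 0 by exact: IH.
by apply/funext => x; exact: derive_cst.
Qed.

Lemma Ck_id V k (U : set V) : Ck k U (id : V -> V).
Proof.
case: k => [|k]; first by move=> x _; exact: cvg_id.
split=> [x _|v]; first by case: (is_diff_id x).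
suff -> : 'D_v (id : V -> V) = fun=> v by exact: Ck_cst.
by apply/funext => x; exact: derive_id.
Qed.

Lemma CkD V W k (U : set V) (f g : V -> W) : open U ->
  Ck k U f -> Ck k U g -> Ck k U (fun x => f x + g x).
Proof.
move=> Uo; elim: k f g => [|k IH] f g /=.
  by move=> fc gc x Ux; apply: continuousD; [exact: fc|exact: gc].
move=> [df Df] [dg Dg]; split=> [x Ux|v].
  by apply: differentiableD; [exact: df|exact: dg].
apply: eq_Ck (IH _ _ (Df v) (Dg v)) => // x Ux.
by rewrite -deriveD//; apply: diff_derivable; [exact: df|exact: dg].
Qed.

Lemma Ck_scale V W k (U : set V) (f : V -> R^o) (g : V -> W) : open U ->
  Ck k U f -> Ck k U g -> Ck k U (fun x => f x *: g x).
Proof.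
move=> Uo; elim: k f g => [|k IH] f g /=.
  by move=> fc gc x Ux; apply: continuousZ; [exact: fc|exact: gc].
move=> Cf Cg; have [df Df] := Cf; have [dg Dg] := Cg; split=> [x Ux|v].
  by apply: differentiable_scale; [exact: df|exact: dg].
have [Cf' Cg'] := (CkW Cf, CkW Cg).
apply: eq_Ck (CkD Uo (IH _ _ (Df v) Cg') (IH _ _ Cf' (Dg v))) => // x Ux.
by rewrite derive_scale//; [exact: df|exact: dg].
Qed.

Lemma Ck_linear_comp (V W W' : normedModType R) k (U : set V) (f : V -> W)
    (l : W -> W') : open U -> linear l -> continuous l ->
  Ck k U f -> Ck k U (fun x => l (f x)).
Proof.
move=> Uo llin lc; elim: k f => [|k IH] f /=.
  by move=> fc x Ux; apply: continuous_comp; [exact: fc|exact: lc].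
move=> [df Df]; split=> [x Ux|v].
  apply: differentiable_comp (df x Ux) _.
  by have [] := linear_diff (f x) llin lc.
apply: eq_Ck (IH _ (Df v)) => // x Ux.
by apply/esym/derive_linear_comp => //; exact: df.
Qed.

(** For an affine inner map, the derivative along [v] is the derivative of [f] along the fixed
    vector [l v], composed with the same affine map, so the induction closes. Straight lines in a
    chart and the projection of End(TM) to M are of this kind. *)
Lemma Ck_comp_affine (V V' W : normedModType R) k (U : set V) (f : V -> W)
    (l : V' -> V) b : open U -> linear l -> continuous l ->
  Ck k U f -> Ck k [set x | U (b + l x)] (fun x => f (b + l x)).
Proof.
move=> Uo llin lc.
have ac : continuous (fun x => b + l x).
  by move=> x; apply: continuousD; [exact: cst_continuous|exact: lc].
have ad x : differentiable (fun x => b + l x) x.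
  apply: differentiableD; first exact: differentiable_cst.
  by have [] := linear_diff x llin lc.
have aD x v : 'D_v (fun x => b + l x) x = l v.
  have ld := linear_diff x llin lc; have lx : differentiable l x by case: ld.
  rewrite (@deriveD _ _ _ (cst b) l); last 2 first.
    exact: derivable_cst.
    exact: diff_derivable.
  by rewrite derive_cst add0r deriveE// diff_val.
have Uo' : open [set x | U (b + l x)].
  by apply: open_comp => // x _; exact: ac.
elim: k f => [|k IH] f /=.
  move=> fc x Ux; apply: (@continuous_comp _ _ _ (fun x => b + l x) f).
    exact: ac.
  exact: fc.
move=> [df Df]; split=> [x Ux|v].
  by apply: (@differentiable_comp _ _ _ _ (fun x => b + l x) f) => //; exact: df.
apply: eq_Ck (IH _ (Df (l v))) => // x Ux.
rewrite (@derive_comp _ _ _ _ (fun x => b + l x) f)//; last exact: df.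
by rewrite aD.
Qed.

(** One step of a bootstrap: by the chain rule, order [k] for [dphi \o f] gives order [k + 1] for
    [phi \o f]. It closes for [exp], [inv] and [ln], where [dphi] is [exp] itself, a polynomial in
    [inv], and [inv]. *)
Lemma Ck_comp1 V k (U : set V) (f : V -> R^o) (phi dphi : R -> R) : open U ->
  (forall x, U x -> is_derive (f x) 1 phi (dphi (f x))) ->
  Ck k U (dphi \o f : V -> R^o) -> Ck k.+1 U f -> Ck k.+1 U (phi \o f : V -> R^o).
Proof.
move=> Uo dphiE Cd Cf; have [df Df] := Cf; split=> [x Ux|v].
  by have [] := derive_comp1 0 (df x Ux) (dphiE x Ux).
apply: eq_Ck (Ck_scale Uo Cd (Df v)) => // x Ux.
by have [_ ->] := derive_comp1 v (df x Ux) (dphiE x Ux).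
Qed.

Lemma Ck_expR V k (U : set V) (f : V -> R^o) : open U ->
  Ck k U f -> Ck k U (expR \o f : V -> R^o).
Proof.
move=> Uo; elim: k => [|k IH] Cf.
  by move=> x Ux; apply: continuous_comp; [exact: Cf|exact: continuous_expR].
apply: Ck_comp1 => //; exact/IH/CkW.
Qed.

Lemma Ck_inv V k (U : set V) (f : V -> R^o) : open U ->
  (forall x, U x -> f x != 0) ->
  Ck k U f -> Ck k U (fun x => (f x)^-1 : R^o).
Proof.
move=> Uo f0; elim: k => [|k IH] Cf.
  by move=> x Ux; apply: continuousV; [exact: f0|exact: Cf].
have Ci := IH (CkW Cf).
apply: (@Ck_comp1 _ _ _ _ GRing.inv (fun y => - (y^-1 * y^-1))) => //.
  move=> x Ux; apply: is_derive_eq.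
    by apply: (@is_deriveV _ id); exact: f0.
  by rewrite /= -[LHS]/(- (f x) ^- 2 * 1) mulr1 expr2 invfM.
apply: (@eq_Ck _ _ _ _ (fun x : V => (-1 : R^o) *: ((f x)^-1 *: ((f x)^-1 : R^o)))) => //.
  by move=> x _; rewrite scaleN1r.
exact: Ck_scale (Ck_cst _ _ _) (Ck_scale Uo Ci Ci).
Qed.

Lemma Ck_ln V k (U : set V) (f : V -> R^o) : open U ->
  (forall x, U x -> 0 < f x) ->
  Ck k U f -> Ck k U (fun x => ln (f x) : R^o).
Proof.
move=> Uo f0; elim: k => [|k IH] Cf.
  move=> x Ux; apply: (@continuous_comp _ _ _ f (@ln R)); first exact: Cf.
  exact: continuous_ln (f0 x Ux).
apply: (@Ck_comp1 _ _ _ _ (@ln R) GRing.inv) => //.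
  by move=> x Ux; exact/is_derive1_ln/f0.
apply: Ck_inv => //; last exact: CkW.
by move=> x /f0; rewrite lt0r => /andP[].
Qed.

Lemma Ck_pair (V W W' : normedModType R) k (U : set V)
    (f : V -> W) (g : V -> W') : open U ->
  Ck k U f -> Ck k U g -> Ck k U (fun x => (f x, g x)).
Proof.
move=> Uo Cf Cg.
have C1 : Ck k U (fun x => (f x, 0 : W')).
  apply: (Ck_linear_comp (l := fun y => (y, 0))) Cf => //.
    by move=> a x y; congr (_, _); rewrite /= ?scaler0 ?addr0.
  by move=> y; apply: cvg_pair; [exact: cvg_id|exact: cvg_cst].
have C2 : Ck k U (fun x => (0 : W, g x)).
  apply: (Ck_linear_comp (l := fun y => (0, y))) Cg => //.
    by move=> a x y; congr (_, _); rewrite /= ?scaler0 ?addr0.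
  by move=> y; apply: cvg_pair; [exact: cvg_cst|exact: cvg_id].
apply: eq_Ck (CkD Uo C1 C2) => // x _.
by congr (_, _); rewrite ?addr0 ?add0r.
Qed.
End CkCalculus.

(** * Symmetric tensors normalizing a quaternionic structure *)

Section QuaternionicAlgebra.
Variables (R : realType) (m : nat).
Implicit Types (J T A B : 'M[R]_m) (X Y : 'cV[R]_m).

Definition mxcomm T A : 'M[R]_m := T *m A - A *m T.

Lemma mx_eq_cV A B : (forall X, A *m X = B *m X) -> A = B.
Proof.
move=> AB; apply/matrixP => i j.
have /(congr1 (fun C : 'cV_m => C i 0)) := AB (delta_mx j 0).
by rewrite -!colE !mxE.
Qed.

(** Facts proved for [J1] become facts about [J2] and [J3] by renaming. *)
Lemma admissible_cycle J1 J2 J3 :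
  admissible J1 J2 J3 -> admissible J2 J3 J1.
Proof.
move=> [h1 h2 h3 h12 h21].
have h23 : J2 *m J3 = J1.
  by rewrite -[J3]opprK -h21 mulmxN mulmxA h2 mul_scalar_mx scaleN1r opprK.
split => //.
by rewrite -h12 -mulmxA h2 mul_mx_scalar scaleN1r.
Qed.

(** Packed as one tuple so that a single [rewrite] evaluates every product of units. *)
Lemma admissible_table J1 J2 J3 : admissible J1 J2 J3 ->
  ((J1 *m J1 = (-1)%:M) * (J2 *m J2 = (-1)%:M) * (J3 *m J3 = (-1)%:M) *
   (J1 *m J2 = J3) * (J2 *m J1 = - J3) * (J2 *m J3 = J1) * (J3 *m J2 = - J1) *
   (J3 *m J1 = J2) * (J1 *m J3 = - J2))%type.
Proof.
move=> h; have [h1 h2 h3 h12 h21] := h.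
have [_ _ _ h23 h32] := admissible_cycle h.
by have [_ _ _ h31 h13] := admissible_cycle (admissible_cycle h).
Qed.

Lemma qdotDl A A' B : qdot (A + A') B = qdot A B + qdot A' B.
Proof. by rewrite /qdot mulmxDl mxtraceD opprD mulrDl. Qed.

Lemma qdotZl a A B : qdot (a *: A) B = a * qdot A B.
Proof. by rewrite /qdot -scalemxAl mxtraceZ -mulrN mulrA. Qed.

Lemma qdotC A B : qdot A B = qdot B A.
Proof. by rewrite /qdot mxtrace_mulC. Qed.

Lemma qdotDr A B B' : qdot A (B + B') = qdot A B + qdot A B'.
Proof. by rewrite !(qdotC A) qdotDl. Qed.

Lemma qdotZr a A B : qdot A (a *: B) = a * qdot A B.
Proof. by rewrite !(qdotC A) qdotZl. Qed.

Lemma qdotNr A B : qdot A (- B) = - qdot A B.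
Proof. by rewrite -scaleN1r qdotZr mulN1r. Qed.

Lemma qdot_mxcomm T A B : qdot (mxcomm T A) B = - qdot A (mxcomm T B).
Proof.
rewrite /qdot /mxcomm mulmxBl mulmxBr !raddfB /= mulmxA.
rewrite -[T *m A *m B]mulmxA (mxtrace_mulC T) -!mulmxA.
by rewrite -mulNr opprB.
Qed.

Hypothesis m_gt0 : (0 < m)%N.

Section AdmissibleBasis.
Variables J1 J2 J3 : 'M[R]_m.
Hypothesis J_adm : admissible J1 J2 J3.

Definition quat (a b c : R) : 'M[R]_m := a *: J1 + b *: J2 + c *: J3.

(** The product of imaginary quaternions: minus the scalar product, plus the cross product. *)
Lemma quat_mul a b c a' b' c' :
  quat a b c *m quat a' b' c' =
  (- (a * a' + b * b' + c * c'))%:M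
  + quat (b * c' - c * b') (c * a' - a * c') (a * b' - b * a').
Proof.
rewrite /quat !mulmxDl !mulmxDr -!scalemxAl -!scalemxAr !(admissible_table J_adm).
by apply/matrixP => i j; rewrite !mxE; case: (i == j); rewrite /= ?mulr1n ?mulr0n; ring.
Qed.

Lemma qdot_quat a b c a' b' c' :
  qdot (quat a b c) (quat a' b' c') = a * a' + b * b' + c * c'.
Proof.
have [[h11 h22 h33] [h12 h13 h23]] := qdot_admissible m_gt0 J_adm.
rewrite /quat !(qdotDl, qdotDr, qdotZl, qdotZr).
rewrite h11 h22 h33 h12 h13 h23 (qdotC J2 J1) (qdotC J3 J1) (qdotC J3 J2).
by rewrite h12 h13 h23; ring.
Qed.

(** As [J1], [J2], [J3] are orthonormal, the coefficients of the commutator are its scalar products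
    with them. Cyclicity of the trace moves [T] to the other factor, which becomes [[J1, J1] = 0],
    [[J1, J2] = 2 J3] or [[J1, J3] = - 2 J2]. *)
Lemma mxcomm_admissible T a b c :
  mxcomm T J1 = quat a b c ->
  mxcomm T J1 = quat 0 (2 * qdot J3 T) (- 2 * qdot J2 T).
Proof.
move=> TJ; have [[h11 h22 h33] [h12 h13 h23]] := qdot_admissible m_gt0 J_adm.
have E a' b' c' : qdot (mxcomm T J1) (quat a' b' c') = a * a' + b * b' + c * c'.
  by rewrite TJ qdot_quat.
have C A : qdot (mxcomm T J1) A = qdot T (mxcomm J1 A).
  rewrite /qdot /mxcomm mulmxBl mulmxBr !raddfB /= mulmxA.
  by rewrite -[J1 *m T *m A]mulmxA (mxtrace_mulC J1) -!mulmxA.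
have a0 : a = 0.
  have := E 1 0 0; rewrite C (_ : mxcomm _ _ = 0 *: J1).
    by rewrite qdotZr mul0r; lra.
  by rewrite /quat /mxcomm scale1r !scale0r !addr0 subrr.
have bE : b = 2 * qdot J3 T.
  have := E 0 1 0; rewrite C (_ : mxcomm _ _ = 2 *: J3).
    rewrite qdotZr (qdotC J3); lra.
  rewrite /quat /mxcomm !scale0r add0r addr0 scale1r !(admissible_table J_adm).
  by rewrite opprK -mulr2n scaler_nat.
have cE : c = - 2 * qdot J2 T.
  have := E 0 0 1; rewrite C (_ : mxcomm _ _ = (- 2) *: J2).
    rewrite qdotZr (qdotC J2); lra.
  rewrite /quat /mxcomm !scale0r !add0r scale1r !(admissible_table J_adm).
  by rewrite -opprD -mulr2n scaleNr scaler_nat.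
by rewrite TJ a0 bE cE.
Qed.
End AdmissibleBasis.

Lemma quat_cycle J1 J2 J3 a b c : quat J1 J2 J3 a b c = quat J2 J3 J1 b c a.
Proof. by rewrite /quat -addrA addrC. Qed.

Lemma mxtrace_rank1 (X : 'cV[R]_m) (w : 'rV[R]_m) : \tr (X *m w) = (w *m X) 0 0.
Proof. by rewrite mxtrace_mulC [LHS]big_ord1. Qed.

Section Prolongation.
Variable S : 'cV[R]_m -> 'M[R]_m.
Hypothesis S_lin : linear S.
Hypothesis S_sym : forall X Y, S X *m Y = S Y *m X.

Let S_D X Y : S (X + Y) = S X + S Y.
Proof. by have := S_lin 1 X Y; rewrite !scale1r. Qed.

Let S_0 : S 0 = 0.
Proof. by apply: (addrI (S 0)); rewrite -S_D !addr0. Qed.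

Let S_Z a X : S (a *: X) = a *: S X.
Proof. by have := S_lin a X 0; rewrite !addr0 S_0 addr0. Qed.

Let S_N X : S (- X) = - S X.
Proof. by rewrite -scaleN1r S_Z scaleN1r. Qed.

Definition stable_span (J1 J2 J3 : 'M[R]_m) := forall X a b c,
  exists a' b' c', mxcomm (S X) (quat J1 J2 J3 a b c) = quat J1 J2 J3 a' b' c'.

Lemma stable_span_cycle J1 J2 J3 :
  stable_span J1 J2 J3 -> stable_span J2 J3 J1.
Proof.
move=> st X a b c; have [a' [b' [c' E]]] := st X c a b.
by exists b', c', a'; rewrite -(quat_cycle J1) -(quat_cycle J1).
Qed.

Lemma mxcomm_stable J1 J2 J3 X : admissible J1 J2 J3 -> stable_span J1 J2 J3 ->
  mxcomm (S X) J1
  = quat J1 J2 J3 0 (2 * qdot J3 (S X)) (- 2 * qdot J2 (S X)).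
Proof.
move=> adm st; have [a [b [c E]]] := st X 1 0 0.
move: E; rewrite {1}/quat scale1r !scale0r !addr0.
exact: mxcomm_admissible.
Qed.

(** The linear form [X |-> qdot J (S X)] as a row: with it, the map [Y |-> qdot J (S Y) *: (J *m X)]
    becomes a rank-one matrix, whose trace is the value of the form at [J *m X]. *)
Definition qdot_row J : 'rV[R]_m := \row_j qdot J (S (delta_mx j 0)).

Lemma qdot_rowE J X : (qdot_row J *m X) 0 0 = qdot J (S X).
Proof.
rewrite [X in S X](matrix_sum_delta X) mxE.
have -> : S (\sum_i \sum_j X i j *: delta_mx i j) = \sum_i X i 0 *: S (delta_mx i 0).
  rewrite (big_morph S (id1 := 0) (op1 := +%R)) //.
  by apply: eq_bigr => i _; rewrite big_ord1 S_Z.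
rewrite (big_morph (qdot J) (id1 := 0) (op1 := +%R)).
- by apply: eq_bigr => i _; rewrite qdotZr mxE mulrC.
- by move=> A B; rewrite qdotDr.
- by rewrite -(scale0r 0) qdotZr mul0r.
Qed.

(* [N X] is the map [Y |-> L_Y X], where [L_Y], the sum of [S Y] and an element
   of [Q], commutes with the [J_i]; hence [N (J X) = J N X]. *)
Lemma trace_prolongation J1 J2 J3 X :
  admissible J1 J2 J3 -> stable_span J1 J2 J3 ->
  \tr (S (J1 *m X)) = - (m%:R * qdot J1 (S X))
    - 2 * qdot J2 (S (J3 *m X)) + 2 * qdot J3 (S (J2 *m X)).
Proof.
move=> adm st; have tab := admissible_table adm.
pose L Y := S Y - quat J1 J2 J3 (qdot J1 (S Y)) (qdot J2 (S Y)) (qdot J3 (S Y)).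
have LJ Y : L Y *m J1 = J1 *m L Y.
  have SJ : S Y *m J1
      = quat J1 J2 J3 0 (2 * qdot J3 (S Y)) (- 2 * qdot J2 (S Y)) + J1 *m S Y.
    by rewrite -(mxcomm_stable _ adm st) subrK.
  rewrite /L mulmxBl mulmxBr SJ.
  rewrite /quat !mulmxDl !mulmxDr -!scalemxAl -!scalemxAr !tab.
  by apply/matrixP => i j; rewrite !mxE; ring.
pose N X := S X - (J1 *m X *m qdot_row J1 + J2 *m X *m qdot_row J2
  + J3 *m X *m qdot_row J3).
have NE Z Y : N Z *m Y = L Y *m Z.
  have E J : J *m Z *m qdot_row J *m Y = qdot J (S Y) *: (J *m Z).
    rewrite -mulmxA [qdot_row J *m Y]mx11_scalar qdot_rowE.
    by rewrite mul_mx_scalar.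
  rewrite /N mulmxBl !mulmxDl !E S_sym /L /quat.
  by rewrite mulNmx !mulmxDl -!scalemxAl.
have NJ : N (J1 *m X) = J1 *m N X.
  by apply: mx_eq_cV => Y; rewrite -mulmxA !NE !mulmxA LJ.
have := congr1 mxtrace NJ.
rewrite /N mulmxBr !mulmxDr !raddfB /= !raddfD /= !mulmxA.
have J1S : \tr (J1 *m S X) = - (m%:R * qdot J1 (S X)).
  by rewrite /qdot mulrC divfK ?pnatr_eq0 -?lt0n// opprK.
rewrite !tab !mxtrace_rank1 !qdot_rowE !mulNmx !mul_scalar_mx J1S.
rewrite !scaleN1r !S_N !qdotNr; lra.
Qed.

(** Put [b_i (Y) = qdot J_i (S (J_i *m Y))]. At [- J_i *m Y], the trace formula and its cyclic
    permutations read [tr (S Y) = m b_i + 2 b_j + 2 b_k]. Subtracting two of them gives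
    [(m - 2) (b_i - b_j) = 0], so for [m != 2] the three forms coincide and
    [tr (S Y) = (m + 4) b_1]. *)
Lemma qdot_prolongation J1 J2 J3 X : m != 2%N ->
  admissible J1 J2 J3 -> stable_span J1 J2 J3 ->
  qdot J1 (S X) = - (\tr (S (J1 *m X)) / (m%:R + 4)).
Proof.
move=> m2 adm st; have tab := admissible_table adm.
pose b J Y := qdot J (S (J *m Y)).
have st2 := stable_span_cycle st; have st3 := stable_span_cycle st2.
have adm2 := admissible_cycle adm; have adm3 := admissible_cycle adm2.
have t1 Y : \tr (S Y) = m%:R * b J1 Y + 2 * b J2 Y + 2 * b J3 Y.
  have := trace_prolongation (- (J1 *m Y)) adm st.
  rewrite !mulmxN !mulmxA !tab !mulNmx !mul_scalar_mx !scaleN1r !opprK.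
  by rewrite !S_N !qdotNr /b; lra.
have t2 Y : \tr (S Y) = m%:R * b J2 Y + 2 * b J3 Y + 2 * b J1 Y.
  have := trace_prolongation (- (J2 *m Y)) adm2 st2.
  rewrite !mulmxN !mulmxA !tab !mulNmx !mul_scalar_mx !scaleN1r !opprK.
  by rewrite !S_N !qdotNr /b; lra.
have t3 Y : \tr (S Y) = m%:R * b J3 Y + 2 * b J1 Y + 2 * b J2 Y.
  have := trace_prolongation (- (J3 *m Y)) adm3 st3.
  rewrite !mulmxN !mulmxA !tab !mulNmx !mul_scalar_mx !scaleN1r !opprK.
  by rewrite !S_N !qdotNr /b; lra.
have m20 : m%:R - 2 != 0 :> R by rewrite subr_eq0 eqr_nat.
have m40 : m%:R + 4 != 0 :> R by rewrite -natrD pnatr_eq0 addn4.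
have e12 Y : b J1 Y = b J2 Y.
  apply: (mulfI m20); have := t1 Y; rewrite t2; lra.
have e13 Y : b J1 Y = b J3 Y.
  apply: (mulfI m20); have := t1 Y; rewrite t3; lra.
have -> : qdot J1 (S X) = - b J1 (J1 *m X).
  by rewrite /b mulmxA tab mul_scalar_mx scaleN1r S_N qdotNr; lra.
rewrite t1 -e12 -e13; field.
exact: m40.
Qed.

Definition prolongation_form X : R := \tr (S X) / (m%:R + 4).
Local Notation al := prolongation_form.

(** With [P = sum_i al (J_i X) J_i], the right-hand side is twice the cross product of [(a, b, c)]
    with [P], so [S X] acts on the span as [- [P, .]]. *)
Lemma prolongation_formP (J1 J2 J3 : 'M[R]_m) X a b c : m != 2%N ->
  admissible J1 J2 J3 -> stable_span J1 J2 J3 ->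
  mxcomm (S X) (quat J1 J2 J3 a b c)
  = 2 *: quat J1 J2 J3 (b * al (J3 *m X) - c * al (J2 *m X))
      (c * al (J1 *m X) - a * al (J3 *m X)) (a * al (J2 *m X) - b * al (J1 *m X)).
Proof.
move=> m2 adm st.
have st2 := stable_span_cycle st; have st3 := stable_span_cycle st2.
have adm2 := admissible_cycle adm; have adm3 := admissible_cycle adm2.
have q1 := qdot_prolongation X m2 adm st.
have q2 := qdot_prolongation X m2 adm2 st2.
have q3 := qdot_prolongation X m2 adm3 st3.
have c1 := mxcomm_stable X adm st.
have c2 := mxcomm_stable X adm2 st2.
have c3 := mxcomm_stable X adm3 st3.
have -> : mxcomm (S X) (quat J1 J2 J3 a b c) =
    a *: mxcomm (S X) J1 + b *: mxcomm (S X) J2 + c *: mxcomm (S X) J3.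
  rewrite /mxcomm /quat !mulmxDl !mulmxDr -!scalemxAl -!scalemxAr.
  by apply/matrixP => i j; rewrite !mxE; ring.
rewrite c1 c2 c3 q1 q2 q3 /quat /prolongation_form.
by apply/matrixP => i j; rewrite !mxE; ring.
Qed.

Lemma prolongation_form_quat J1 J2 J3 X a b c :
  al (quat J1 J2 J3 a b c *m X)
  = a * al (J1 *m X) + b * al (J2 *m X) + c * al (J3 *m X).
Proof.
rewrite /prolongation_form /quat !mulmxDl -!scalemxAl !S_D !S_Z.
by rewrite !mxtraceD !mxtraceZ; ring.
Qed.

(** With [P] as above, the commutator is [2 A x P]. Split [P] along [J] and its orthogonal. As [A]
    is orthogonal to [J], the orthogonal part contributes a multiple of [J], which the projection
    kills; the other part leaves [2 <J, P> A x J = - 2 al (J X) J A]. *)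
Lemma prolongation_proj J1 J2 J3 J A X : m != 2%N ->
  admissible J1 J2 J3 -> stable_span J1 J2 J3 ->
  (exists a b c, J = quat J1 J2 J3 a b c) ->
  (exists a b c, A = quat J1 J2 J3 a b c) ->
  qdot J J = 1 -> qdot J A = 0 ->
  mxcomm (S X) A - qdot J (mxcomm (S X) A) *: J
  = (- 2 * al (J *m X)) *: (J *m A).
Proof.
move=> m2 adm st [a [b [c JE]]] [d [e [f AE]]].
rewrite JE AE !(qdot_quat adm) => JJ JA.
rewrite prolongation_formP// qdotZr (qdot_quat adm) (quat_mul adm) JA.
rewrite prolongation_form_quat oppr0 raddf0 add0r.
set p := al (J1 *m X); set q := al (J2 *m X); set r := al (J3 *m X).
apply/matrixP => i j; rewrite !mxE; apply/eqP; rewrite -subr_eq0; apply/eqP.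
set K1 := J1 i j; set K2 := J2 i j; set K3 := J3 i j.
(* The difference of the two sides is a combination of [1 - |J|^2] and [<J, A>], which both
   vanish. *)
transitivity (2 * ((e * r - f * q) * K1 + (f * p - d * r) * K2
    + (d * q - e * p) * K3) * (1 - (a * a + b * b + c * c))
  + 2 * ((b * r - c * q) * K1 + (c * p - a * r) * K2 + (a * q - b * p) * K3)
    * (a * d + b * e + c * f)); first by ring.
by rewrite JJ JA subrr !mulr0 addr0.
Qed.

(** This makes the complex structure of [Z] independent of the connection. As [J_i J] is [J_i x J]
    minus a scalar, replacing [X] by [J X] turns [P] into [J x P - al (X) J]. The last term has zero
    cross product with [J], so both sides are [2 J x (J x P)]. *)
Lemma prolongation_hor J1 J2 J3 J X : m != 2%N ->
  admissible J1 J2 J3 -> stable_span J1 J2 J3 ->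
  (exists a b c, J = quat J1 J2 J3 a b c) ->
  J *m mxcomm (S X) J = mxcomm (S (J *m X)) J.
Proof.
move=> m2 adm st [a [b [c JE]]]; have tab := admissible_table adm.
have alN Y : al (- Y) = - al Y by rewrite /prolongation_form S_N raddfN mulNr.
rewrite JE !prolongation_formP// -scalemxAr (quat_mul adm).
congr (_ *: _).
rewrite (_ : - _ = 0); last by ring.
rewrite raddf0 add0r !mulmxA.
have E (K : 'M[R]_m) : K *m quat J1 J2 J3 a b c
    = a *: (K *m J1) + b *: (K *m J2) + c *: (K *m J3).
  by rewrite /quat !mulmxDr -!scalemxAr.
rewrite !E !tab !mulmxDl -!scalemxAl !mulNmx !mul_scalar_mx !scaleN1r.
have alD Y Z : al (Y + Z) = al Y + al Z.
  by rewrite /prolongation_form S_D raddfD mulrDl.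
have alZ k Y : al (k *: Y) = k * al Y.
  by rewrite /prolongation_form S_Z mxtraceZ mulrA.
rewrite !alD !alZ !alN; congr (quat _ _ _ _ _ _); ring.
Qed.
End Prolongation.
End QuaternionicAlgebra.

(** * Germs of smooth maps *)

Section SmoothNear.
Variables (R : realType).
Implicit Types (V W : normedModType R).

Lemma smooth_near_eq V W (f g : V -> W) x :
  (\forall y \near x, f y = g y) -> smooth_near x f -> smooth_near x g.
Proof.
move=> fg [U [Uo Ux] fU].
have Io : open (U `&` [set y | f y = g y]^°).
  by apply: openI => //; exact: open_interior.
exists (U `&` [set y | f y = g y]^°); first by split.
move=> k; apply: (eq_Ck (f := f)) => //.
  by move=> y [_ /interior_subset].
by apply: Ck_sub (fU k) => y [].
Qed.

Lemma smooth_near2 V W1 W2 W3 (f : V -> W1) (g : V -> W2) (h : V -> W3) x :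
  (forall k U, open U -> Ck k U f -> Ck k U g -> Ck k U h) ->
  smooth_near x f -> smooth_near x g -> smooth_near x h.
Proof.
move=> H [U [Uo Ux] fU] [U' [Uo' Ux'] gU].
have Io : open (U `&` U') by exact: openI.
exists (U `&` U'); first by split.
by move=> k; apply: H => //; [apply: Ck_sub (fU k)|apply: Ck_sub (gU k)] => y [].
Qed.

Lemma smooth_near_cst V W (a : W) (x : V) : smooth_near x (fun=> a).
Proof.
by exists setT; [split => //; exact: openT|move=> k; exact: Ck_cst].
Qed.

Lemma smooth_nearD V W (f g : V -> W) x :
  smooth_near x f -> smooth_near x g -> smooth_near x (fun y => f y + g y).
Proof. by apply: smooth_near2 => k U; exact: CkD. Qed.

Lemma smooth_near_scale V W (f : V -> R^o) (g : V -> W) x :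
  smooth_near x f -> smooth_near x g -> smooth_near x (fun y => f y *: g y).
Proof. by apply: smooth_near2 => k U; exact: Ck_scale. Qed.

Lemma smooth_near_pair V W W' (f : V -> W) (g : V -> W') x :
  smooth_near x f -> smooth_near x g -> smooth_near x (fun y => (f y, g y)).
Proof. by apply: smooth_near2 => k U; exact: Ck_pair. Qed.

Lemma smooth_near_linear V W W' (f : V -> W) (l : W -> W') x :
  linear l -> continuous l -> smooth_near x f -> smooth_near x (fun y => l (f y)).
Proof.
move=> llin lc [U [Uo Ux] fU]; exists U; first by split.
by move=> k; exact: Ck_linear_comp (fU k).
Qed.

Lemma smooth_near_linear_mx V m n W' (f : V -> 'M[R]_(m, n))
    (l : 'M[R]_(m, n) -> W') x :
  linear l -> smooth_near x f -> smooth_near x (fun y => l (f y)).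
Proof.
by move=> llin; apply: smooth_near_linear => //; exact: linear_mx_continuous.
Qed.

Lemma smooth_near_affine V V' W (f : V -> W) (l : V' -> V) b x :
  linear l -> continuous l -> smooth_near (b + l x) f ->
  smooth_near x (fun y => f (b + l y)).
Proof.
move=> llin lc [U [Uo Ux] fU]; exists [set y | U (b + l y)].
  split => //; apply: open_comp => // y _.
  by apply: continuousD; [exact: cst_continuous|exact: lc].
by move=> k; exact: Ck_comp_affine (fU k).
Qed.

Lemma smooth_near_expR V (f : V -> R^o) x :
  smooth_near x f -> smooth_near x (fun y => expR (f y) : R^o).
Proof.
move=> [U [Uo Ux] fU]; exists U; first by split.
by move=> k; exact: Ck_expR (fU k).
Qed.

Lemma smooth_near_differentiable V W (f : V -> W) x :
  smooth_near x f -> differentiable f x.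
Proof. by move=> [U [Uo Ux] /(_ 1%N) [df _]]; exact: df. Qed.

Lemma smooth_near_inv V (f : V -> R^o) x : f x != 0 ->
  smooth_near x f -> smooth_near x (fun y => (f y)^-1 : R^o).
Proof.
move=> fx0 [U [Uo Ux] fU].
have fc y : U y -> {for y, continuous f} := fU 0%N y.
have Io : open (U `&` [set y | f y != 0]).
  rewrite openE => y [Uy fy0]; apply: filterI; first exact: open_nbhs_nbhs.
  suff : nbhs (f y) [set z : R^o | z != 0] by exact: fc.
  by apply: open_nbhs_nbhs; split => //; exact: open_neq.
exists (U `&` [set y | f y != 0]); first by split.
move=> k; apply: Ck_inv => //; first by move=> y [].
by apply: Ck_sub (fU k) => y [].
Qed.

Lemma smooth_near_ln V (f : V -> R^o) x : 0 < f x ->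
  smooth_near x f -> smooth_near x (fun y => ln (f y) : R^o).
Proof.
move=> fx0 [U [Uo Ux] fU].
have fc y : U y -> {for y, continuous f} := fU 0%N y.
have Io : open (U `&` [set y | 0 < f y]).
  rewrite openE => y [Uy fy0]; apply: filterI; first exact: open_nbhs_nbhs.
  suff : nbhs (f y) [set z : R^o | 0 < z] by exact: fc.
  by apply: open_nbhs_nbhs; split => //; exact: open_gt.
exists (U `&` [set y | 0 < f y]); first by split.
move=> k; apply: Ck_ln => //; first by move=> y [].
by apply: Ck_sub (fU k) => y [].
Qed.
End SmoothNear.

(** * Charts and connections *)

Section Charts.
Variables (R : realType) (m : nat) (M : manifold R m).
Implicit Types (p q : M) (i j : chart M).

Lemma phi_psi i x : (phi M i @` dom M i) x -> phi M i (psi M i x) = x.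
Proof. by move=> [q iq <-]; rewrite phiK. Qed.

Lemma near_dom i q : dom M i q -> \forall r \near q, dom M i r.
Proof. by move=> iq; apply: open_nbhs_nbhs; split => //; exact: dom_open. Qed.

Lemma near_img i q : dom M i q -> \forall x \near phi M i q, (phi M i @` dom M i) x.
Proof.
by move=> iq; apply: open_nbhs_nbhs; split; [exact: img_open|exists q].
Qed.

Lemma near_psi i q (P : M -> Prop) : dom M i q ->
  (\forall r \near q, P r) -> \forall x \near phi M i q, P (psi M i x).
Proof.
move=> iq Pq; have := @psi_continuous _ _ M i (phi M i q).
move=> /(_ (ex_intro2 _ _ q iq erefl)); apply.
by rewrite phiK.
Qed.

Lemma transition_diff i j q : dom M i q -> dom M j q ->
  differentiable (phi M j \o psi M i) (phi M i q).
Proof.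
move=> iq jq; have [d _] := @transition_smooth _ _ M i j 1%N.
by apply: d; exists q.
Qed.

Lemma jac_mul i j x v : differentiable (phi M j \o psi M i) x ->
  jac i j x *m v = 'D_v (phi M j \o psi M i) x.
Proof.
move=> dt; rewrite [in RHS](matrix_sum_delta v).
apply/matrixP => a b; rewrite ord1 {b} !mxE.
rewrite deriveE// linear_sum summxE; apply: eq_bigr => k _.
by rewrite big_ord1 linearZ !mxE -deriveE// mulrC.
Qed.

Lemma jacK i j q : dom M i q -> dom M j q ->
  jac i j (phi M i q) *m jac j i (phi M j q) = 1%:M.
Proof.
move=> iq jq; apply: mx_eq_cV => v; rewrite mul1mx -mulmxA.
have dij := transition_diff iq jq; have dji := transition_diff jq iq.
rewrite (jac_mul _ dij) (jac_mul _ dji).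
have E : phi M i q = (phi M i \o psi M j) (phi M j q) by rewrite /= phiK.
rewrite [in LHS]E -derive_comp//; last by rewrite -E.
rewrite (@near_eq_derive _ _ _ _ id) ?derive_id//.
near=> x; rewrite /= phiK; last by near: x; apply: near_psi => //; exact: near_dom.
by apply: phi_psi; near: x; exact: near_img.
Unshelve. all: by end_near. Qed.

Lemma jac_id i q : dom M i q -> jac i i (phi M i q) = 1%:M.
Proof.
move=> iq; apply: mx_eq_cV => v; rewrite mul1mx jac_mul; last exact: transition_diff.
rewrite (@near_eq_derive _ _ _ _ id) ?derive_id//.
by near=> x; apply: phi_psi; near: x; exact: near_img.
Unshelve. all: by end_near. Qed.

Lemma chart_self p : dom M (chart_at M p) p. Proof. exact: chart_at_dom. Qed.
Hint Resolve chart_self : core.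

Lemma to_coordK p q : dom M (chart_at M p) q -> to_coord p q *m of_coord p q = 1%:M.
Proof. by move=> pq; exact: jacK. Qed.

Lemma of_coordK p q : dom M (chart_at M p) q -> of_coord p q *m to_coord p q = 1%:M.
Proof. by move=> pq; exact: jacK. Qed.

Lemma to_coord_id p : to_coord p p = 1%:M. Proof. exact: jac_id. Qed.
Lemma of_coord_id p : of_coord p p = 1%:M. Proof. exact: jac_id. Qed.

Lemma end_coord_id p A : end_coord p p A = A.
Proof. by rewrite /end_coord to_coord_id of_coord_id mul1mx mulmx1. Qed.

Lemma near_self_dom p : \forall q \near p, dom M (chart_at M p) q.
Proof. exact: near_dom. Qed.

Lemma near_coord p (P : M -> Prop) :
  (\forall q \near p, P q) ->
  \forall x \near phi M (chart_at M p) p, P (psi M (chart_at M p) x).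
Proof. exact: near_psi. Qed.

Lemma psi_phi_self p : psi M (chart_at M p) (phi M (chart_at M p) p) = p.
Proof. by rewrite phiK. Qed.

Lemma smooth_fun_eq (W : normedModType R) p (f g : M -> W) :
  (\forall q \near p, f q = g q) -> smooth_fun p f -> smooth_fun p g.
Proof. by move=> fg; apply: smooth_near_eq; exact: near_coord fg. Qed.

Lemma dirder_eq p X (f g : M -> R) : (\forall q \near p, f q = g q) ->
  dirder p X f = dirder p X g.
Proof. by move=> fg; apply: near_eq_derive; exact: near_coord fg. Qed.

Lemma smooth_coord p a : smooth_fun p (fun q => phi M (chart_at M p) q a 0 : R^o).
Proof.
apply: (smooth_near_linear_mx (l := fun A : 'cV[R]_m => A a 0 : R^o)).
  by move=> k A B; rewrite !mxE.
apply: (smooth_near_eq (f := id)).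
  near=> x; rewrite /= phi_psi//; near: x; exact: near_img.
by exists setT; [split => //; exact: openT|move=> k; exact: Ck_id].
Unshelve. all: by end_near. Qed.

(** Coordinate functions recover a vector from its derivation; this turns [torsion_free], which is
    tested on functions, into an identity of vectors. *)
Lemma dirder_coord p X a : dirder p X (fun q => phi M (chart_at M p) q a 0) = X a 0.
Proof.
rewrite /dirder (@near_eq_derive _ _ _ _ (fun x : 'cV[R]_m => x a 0 : R^o)).
  rewrite (@derive_linear_comp _ _ _ _ id (fun A : 'cV[R]_m => A a 0 : R^o))//.
  - by rewrite derive_id.
  - by move=> k A B; rewrite !mxE.
  - exact: coord_continuous.
near=> x; rewrite /= phi_psi//; near: x; exact: near_img.
Unshelve. all: by end_near. Qed.
End Charts.

Section Connections.
Variables (R : realType) (m : nat) (M : manifold R m).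
Implicit Types (p q : M) (X : 'cV[R]_m) (Y Z : M -> 'cV[R]_m).
Hint Resolve chart_self : core.

Definition const_vf p (v : 'cV[R]_m) q : 'cV[R]_m := of_coord p q *m v.

Lemma smooth_vfD p Y Z :
  smooth_vf p Y -> smooth_vf p Z -> smooth_vf p (fun q => Y q + Z q).
Proof.
move=> sY sZ; apply: smooth_near_eq (smooth_nearD sY sZ).
by near=> x; rewrite /= mulmxDr.
Unshelve. all: by end_near. Qed.

Lemma smooth_vfZ p (f : M -> R) Y : smooth_fun p (f : M -> R^o) ->
  smooth_vf p Y -> smooth_vf p (fun q => f q *: Y q).
Proof.
move=> sf sY; apply: smooth_near_eq (smooth_near_scale sf sY).
by near=> x; rewrite /= scalemxAr.
Unshelve. all: by end_near. Qed.

Lemma smooth_const_vf p v : smooth_vf p (const_vf p v).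
Proof.
apply: (smooth_fun_eq (f := fun=> v)); last exact: smooth_near_cst.
near=> q; rewrite /const_vf mulmxA to_coordK ?mul1mx//.
by near: q; exact: near_self_dom.
Unshelve. all: by end_near. Qed.

Lemma const_vf_id p v : const_vf p v p = v.
Proof. by rewrite /const_vf of_coord_id mul1mx. Qed.

Variable D : covariant_derivative M.
Hypothesis D_conn : linear_connection D.

(** The indicator [f] of [Y = Z] is smooth near [p], being constantly 1 there, and [f Y = f Z] holds
    everywhere. The Leibniz rule at [p], where [f] has value 1 and derivative 0, removes [f] from
    both sides. *)
Lemma conn_local p X Y Z : smooth_vf p Y -> smooth_vf p Z ->
  (\forall q \near p, Y q = Z q) -> D p X Y = D p X Z.
Proof.
move=> sY sZ YZ.
pose f q : R := if `[< Y q = Z q >] then 1 else 0.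
have f1 : \forall q \near p, f q = 1.
  by near=> q; rewrite /f asboolT//; near: q.
have sf : smooth_fun p (f : M -> R^o).
  apply: (smooth_fun_eq (f := fun=> 1 : R^o)); last exact: smooth_near_cst.
  by near=> q; rewrite (near f1 q).
have fp : f p = 1 by exact: nbhs_singleton f1.
have df : dirder p X f = 0.
  rewrite (@dirder_eq _ _ _ _ _ _ (fun=> 1)); last exact: f1.
  exact: derive_cst.
have fYZ : (fun q => f q *: Y q) = (fun q => f q *: Z q).
  apply/funext => q; rewrite /f; case: ifPn; last by rewrite !scale0r.
  by move=> /asboolP ->.
have := congr1 (D p X) fYZ; rewrite !(conn_leibniz D_conn)//.
by rewrite df fp !scale0r !add0r !scale1r.
Unshelve. all: by end_near. Qed.

Lemma conn0 p X : D p X (fun=> 0) = 0.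
Proof.
have s0 : smooth_vf p (fun=> 0).
  apply: smooth_near_eq (smooth_near_cst 0 _).
  by near=> x; rewrite /= mulmx0.
have := conn_add D_conn X s0 s0; rewrite (_ : (fun _ => _) = fun=> 0).
  by move=> /eqP; rewrite -subr_eq0 opprD addNKr oppr_eq0 => /eqP.
by apply/funext => q; rewrite addr0.
Unshelve. all: by end_near. Qed.

Lemma conn_sum p X (I : Type) (r : seq I) (Y : I -> M -> 'cV[R]_m) :
  (forall i, smooth_vf p (Y i)) ->
  smooth_vf p (fun q => \sum_(i <- r) Y i q) /\
  D p X (fun q => \sum_(i <- r) Y i q) = \sum_(i <- r) D p X (Y i).
Proof.
move=> sY; elim: r => [|i r [sr IH]].
  rewrite big_nil (_ : (fun _ => _) = fun=> 0); last first.
    by apply/funext => q; rewrite big_nil.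
  split; last exact: conn0.
  apply: smooth_near_eq (smooth_near_cst 0 _).
  by near=> x; rewrite /= mulmx0.
rewrite big_cons (_ : (fun _ => _) = fun q => Y i q + \sum_(i <- r) Y i q).
  by split; [exact: smooth_vfD | rewrite (conn_add D_conn)// IH].
by apply/funext => q; rewrite big_cons.
Unshelve. all: by end_near. Qed.

(** Near [p] the field is a combination of coordinate fields. Locality allows the replacement, and
    the Leibniz rule separates the derivative of the coefficients from the Christoffel term. *)
Lemma conn_coord p X Y : smooth_vf p Y ->
  D p X Y = 'D_X ((fun q => to_coord p q *m Y q) \o psi M (chart_at M p))
              (phi M (chart_at M p) p) + christoffel D p X *m Y p.
Proof.
move=> sY; set c := chart_at M p.
pose F q := to_coord p q *m Y q.
pose f a q : R := F q a 0.
have coord_lin a : linear (fun A : 'cV[R]_m => A a 0 : R^o).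
  by move=> k A B; rewrite !mxE.
have sf a : smooth_fun p (f a : M -> R^o).
  by apply: (smooth_near_linear_mx (l := fun A : 'cV[R]_m => A a 0 : R^o)) sY.
have sc a : smooth_vf p (coord_vf p a) by exact: smooth_const_vf.
have sfc a : smooth_vf p (fun q => f a q *: coord_vf p a q) by exact: smooth_vfZ.
have [ss sE] := conn_sum X (index_enum 'I_m) sfc.
have YE : \forall q \near p, Y q = \sum_a f a q *: coord_vf p a q.
  near=> q; rewrite -[LHS]mul1mx -(@of_coordK _ _ _ p q); last first.
    by near: q; exact: near_self_dom.
  rewrite -mulmxA -/(F q) [F q]matrix_sum_delta mulmx_sumr.
  by apply: eq_bigr => a _; rewrite big_ord1 -scalemxAr.
rewrite (conn_local X sY ss YE) sE.
under eq_bigr => a _ do rewrite (conn_leibniz D_conn)//.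
rewrite big_split /=; congr (_ + _).
  rewrite [RHS]matrix_sum_delta; apply: eq_bigr => a _.
  rewrite big_ord1 /coord_vf of_coord_id mul1mx; congr (_ *: _).
  apply: (@derive_linear_comp _ _ _ _ _ (fun A : 'cV[R]_m => A a 0 : R^o)) => //.
    exact: coord_continuous.
  exact: smooth_near_differentiable sY.
rewrite [X in _ *m X]matrix_sum_delta mulmx_sumr; apply: eq_bigr => a _.
rewrite big_ord1 -scalemxAr; congr (_ *: _); first by rewrite /f /F to_coord_id mul1mx.
by rewrite -colE; apply/matrixP => b k; rewrite !mxE ord1.
Unshelve. all: by end_near. Qed.

Lemma conn_const_vf p X v : D p X (const_vf p v) = christoffel D p X *m v.
Proof.
rewrite conn_coord; last exact: smooth_const_vf.
rewrite (@near_eq_derive _ _ _ _ (fun=> v)).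
  by rewrite derive_cst add0r const_vf_id.
have := near_coord (near_self_dom p); apply: filterS => x xd.
by rewrite /= /const_vf mulmxA to_coordK// mul1mx.
Qed.

Lemma christoffel_linear p : linear (christoffel D p).
Proof.
move=> a X X'; apply: mx_eq_cV => v.
rewrite mulmxDl -scalemxAl -!conn_const_vf (conn_linear D_conn)//.
exact: smooth_const_vf.
Qed.

Lemma cov_endE p X (A : M -> 'M[R]_m) : smooth_end p A ->
  cov_end D p X A = cov_coord D p X (A p)
    ('D_X ((fun q => end_coord p q (A q)) \o psi M (chart_at M p))
       (phi M (chart_at M p) p)).
Proof.
move=> sA; have dA := smooth_near_differentiable sA.
have sAv v : smooth_vf p (fun q => A q *m const_vf p v q).
  apply: (smooth_near_eq (f := fun x => ((fun q => end_coord p q (A q)) \o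
      psi M (chart_at M p)) x *m v)).
    by near=> x; rewrite /= /end_coord /const_vf !mulmxA.
  apply: (smooth_near_linear_mx (l := mulmxr v)) sA.
  exact: linearP.
have E v : D p X (fun q => A q *m const_vf p v q)
    - A p *m D p X (const_vf p v) =
    cov_coord D p X (A p)
    ('D_X ((fun q => end_coord p q (A q)) \o psi M (chart_at M p))
       (phi M (chart_at M p) p)) *m v.
  rewrite conn_const_vf conn_coord// const_vf_id.
  rewrite /cov_coord !mulmxDl mulNmx !mulmxA addrA; congr (_ + _ - _).
  rewrite -[RHS]/(mulmxr v _) -(@derive_linear_comp _ _ _ _ _ (mulmxr v))//.
  - apply: near_eq_derive; near=> x.
    by rewrite /= /end_coord /const_vf !mulmxA.
  - exact: linearP.
  - by apply: linear_mx_continuous; exact: linearP.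
apply/matrixP => a j; rewrite [LHS]mxE.
rewrite [LHS](congr1 (fun B : 'cV_m => B a 0) (E (delta_mx j 0))).
by rewrite -colE mxE.
Unshelve. all: by end_near. Qed.

(** At [p] the coordinate frame is the identity matrix. The j-th term is thus the determinant of the
    identity with column [j] replaced by that of the Christoffel matrix, which is a diagonal entry
    of the latter. *)
Lemma preserves_form_trace (w : M -> R) p X : preserves_form D w ->
  dirder p X (fun q => top_form w q (fun j => coord_vf p j q))
  = w p * \tr (christoffel D p X).
Proof.
move=> Dw; rewrite (Dw p X (fun j => coord_vf p j)); last first.
  by move=> j; exact: smooth_const_vf.
rewrite /top_form -mulr_sumr; congr (_ * _).
apply: eq_bigr => j _; set F := frame_mx _.
have FE i b : F i b = if b == j then christoffel D p X i j else (i == b)%:R.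
  rewrite mxE; case: ifPn => _; first by rewrite mxE.
  by rewrite /coord_vf of_coord_id mul1mx mxE eqxx andbT.
(* Cofactors along column [j] do not see that column, so they are those of the identity. *)
have cofF i : cofactor F i j = (i == j)%:R.
  have <- : cofactor 1%:M i j = (i == j)%:R :> R.
    have /matrixP/(_ j i) := mul_mx_adj (1%:M : 'M[R]_m).
    by rewrite mul1mx det1 mxE => ->; rewrite mxE eq_sym.
  rewrite /cofactor; congr (_ * \det _); apply/matrixP => k l.
  rewrite [LHS]mxE [LHS]mxE FE (eq_sym _ j) (negbTE (neq_lift _ _)).
  by rewrite !mxE.
rewrite (expand_det_col _ j) (bigD1 j)//= big1 => [|i ij].
  by rewrite addr0 FE cofF !eqxx mulr1.
by rewrite cofF (negbTE ij) mulr0.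
Qed.
End Connections.

(** * The difference tensor of two connections *)

Section ConnectionDifference.
Variables (R : realType) (m : nat) (M : manifold R m).
Variables D D' : covariant_derivative M.
Hypotheses (D_conn : linear_connection D) (D'_conn : linear_connection D').
Implicit Types (p q : M) (X : 'cV[R]_m).

Definition conn_diff p X : 'M[R]_m := christoffel D' p X - christoffel D p X.

Lemma conn_diff_linear p : linear (conn_diff p).
Proof.
move=> a X Y; rewrite /conn_diff (christoffel_linear D_conn).
rewrite (christoffel_linear D'_conn) scalerBr opprD !addrA; congr (_ - _).
by rewrite -!addrA; congr (_ + _); rewrite addrC.
Qed.

(* The Lie bracket cancels, so that no symmetry of second derivatives is needed. *)
Lemma conn_diff_sym p X Y : torsion_free D -> torsion_free D' ->
  conn_diff p X *m Y = conn_diff p Y *m X.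
Proof.
move=> D_tf D'_tf.
have sv v := smooth_const_vf p v.
suff E : christoffel D p X *m Y - christoffel D p Y *m X =
    christoffel D' p X *m Y - christoffel D' p Y *m X.
  rewrite /conn_diff !mulmxBl.
  have -> : christoffel D p X *m Y
      = christoffel D' p X *m Y - christoffel D' p Y *m X + christoffel D p Y *m X.
    by rewrite -E subrK.
  by rewrite !opprD opprK !addrA subrr add0r.
apply/matrixP => a b; rewrite ord1 -!(dirder_coord p _ a).
have := D_tf p (const_vf p X) (const_vf p Y) _ (sv X) (sv Y) (smooth_coord p a).
rewrite -(D'_tf p (const_vf p X) (const_vf p Y) _ (sv X) (sv Y) (smooth_coord p a)).
by rewrite !const_vf_id !conn_const_vf.
Qed.

Lemma cov_coord_diff p X (A0 A1 : 'M[R]_m) :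
  cov_coord D' p X A0 A1 = cov_coord D p X A0 A1 + mxcomm (conn_diff p X) A0.
Proof.
rewrite /cov_coord /mxcomm /conn_diff mulmxBl mulmxBr.
by apply/matrixP => i j; rewrite !mxE; ring.
Qed.
End ConnectionDifference.

(** * Product rules for matrix-valued maps *)

Section MatrixCalculus.
Variables (R : realType).
Implicit Types (V W : normedModType R).

Lemma mulmx_delta_sum m n k (A : 'M[R]_(m, n)) (B : 'M[R]_(n, k)) :
  A *m B = \sum_i \sum_j A i j *: (delta_mx i j *m B).
Proof.
rewrite [in LHS](matrix_sum_delta A) mulmx_suml; apply: eq_bigr => i _.
by rewrite mulmx_suml; apply: eq_bigr => j _; rewrite scalemxAl.
Qed.

Lemma derive_mulmx V m n k (f : V -> 'M[R]_(m, n)) (g : V -> 'M[R]_(n, k)) x v :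
  differentiable f x -> differentiable g x ->
  differentiable (fun y => f y *m g y) x /\
  'D_v (fun y => f y *m g y) x = 'D_v f x *m g x + f x *m 'D_v g x.
Proof.
move=> df dg.
have el (i : 'I_m) (j : 'I_n) : linear (fun A : 'M[R]_(m, n) => A i j : R^o).
  by move=> a A B; rewrite !mxE.
have ec (i : 'I_m) (j : 'I_n) : continuous (fun A : 'M[R]_(m, n) => A i j : R^o).
  exact: coord_continuous.
have dl (i : 'I_m) (j : 'I_n) : linear (mulmx (delta_mx i j) : 'M[R]_(n, k) -> _).
  exact: linearP.
have dc (i : 'I_m) (j : 'I_n) : continuous (mulmx (delta_mx i j) : 'M[R]_(n, k) -> _).
  exact/linear_mx_continuous/dl.
pose F i j y : 'M[R]_(m, k) := f y i j *: (delta_mx i j *m g y).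
have df' i j : differentiable (fun y => f y i j : R^o) x.
  apply: (@differentiable_comp _ _ _ _ f (fun A : 'M[R]_(m, n) => A i j : R^o)) => //.
  exact: differentiable_coord.
have dg' i j : differentiable (fun y => (delta_mx i j : 'M[R]_(m, n)) *m g y) x.
  apply: (@differentiable_comp _ _ _ _ g (mulmx (delta_mx i j))) => //.
  by have [] := linear_diff (g x) (dl i j) (dc i j).
have dF i j : differentiable (F i j) x by exact: differentiable_scale.
have DF i j : 'D_v (F i j) x = 'D_v f x i j *: (delta_mx i j *m g x)
    + f x i j *: (delta_mx i j *m 'D_v g x).
  rewrite derive_scale// (derive_linear_comp _ (el i j) (ec i j))//.
  by rewrite (derive_linear_comp _ (dl i j) (dc i j)).
have fgE : (fun y => f y *m g y) = \sum_i \sum_j F i j.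
  by apply/funext => y; rewrite mulmx_delta_sum !fct_sumE; apply: eq_bigr => i _;
    rewrite fct_sumE.
have dF' i : differentiable (\sum_j F i j) x by exact: differentiable_sum.
rewrite fgE; split; first exact: differentiable_sum.
rewrite derive_sum; last by move=> i; exact: diff_derivable.
rewrite !mulmx_delta_sum -big_split; apply: eq_bigr => i _ /=.
rewrite derive_sum; last by move=> j; exact: diff_derivable.
by rewrite -big_split; apply: eq_bigr => j _ /=; rewrite DF.
Qed.

Lemma derive_qdot V m (f g : V -> 'M[R]_m) x v :
  differentiable f x -> differentiable g x ->
  differentiable (fun y => qdot (f y) (g y) : R^o) x /\
  'D_v (fun y => qdot (f y) (g y) : R^o) x
    = qdot ('D_v f x) (g x) + qdot (f x) ('D_v g x).
Proof.
move=> df dg; pose l (A : 'M[R]_m) : R^o := - \tr A / m%:R.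
have ll : linear l.
  by move=> a A B; rewrite /l mxtraceD mxtraceZ opprD mulrDl -mulrN -mulrA.
have lc := linear_mx_continuous ll.
have [dfg Dfg] := derive_mulmx v df dg.
split.
  apply: (@differentiable_comp _ _ _ _ (fun y => f y *m g y) l) => //.
  by have [] := linear_diff (f x *m g x) ll lc.
rewrite (derive_linear_comp v ll lc dfg) Dfg.
by rewrite /l /qdot mxtraceD opprD mulrDl.
Qed.
End MatrixCalculus.

(** * The twistor space *)

Section Coordinates.
Variables (R : realType) (m : nat) (M : manifold R m).
Implicit Types (p q : M) (z : End_TM M).
Hint Resolve chart_self : core.

Lemma end_coordD p q A B :
  end_coord p q (A + B) = end_coord p q A + end_coord p q B.
Proof. by rewrite /end_coord mulmxDr mulmxDl. Qed.

Lemma end_coordZ p q a A : end_coord p q (a *: A) = a *: end_coord p q A.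
Proof. by rewrite /end_coord -scalemxAr -scalemxAl. Qed.

Lemma end_coord_quat p q J1 J2 J3 a b c :
  end_coord p q (quat J1 J2 J3 a b c)
  = quat (end_coord p q J1) (end_coord p q J2) (end_coord p q J3) a b c.
Proof. by rewrite /quat !end_coordD !end_coordZ. Qed.

Lemma qdot_end_coord p q A B : dom M (chart_at M p) q ->
  qdot (end_coord p q A) (end_coord p q B) = qdot A B.
Proof.
move=> pq; rewrite /qdot /end_coord -!mulmxA.
rewrite (mulmxA (of_coord p q) (to_coord p q)) of_coordK// mul1mx.
by rewrite mxtrace_mulC -!mulmxA of_coordK// mulmx1.
Qed.

Lemma E_pointK z y : dom M (chart_at M z.1) y.1 ->
  E_point z.1 (E_coord z.1 y) = y.
Proof.
case: y => q A /= pq; rewrite /E_point /E_coord /= phiK//; congr (_, _).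
by rewrite /end_coord !mulmxA of_coordK// mul1mx -mulmxA of_coordK// mulmx1.
Qed.

Lemma E_coord_self z : E_coord z.1 z = (phi M (chart_at M z.1) z.1, z.2).
Proof. by rewrite /E_coord end_coord_id. Qed.

(* [d_Z] does not depend on the extension picked by [xget], because [u] is the
   velocity of a curve in [Z]. *)
Lemma d_ZE (Q : M -> set 'M[R]_m) (W : normedModType R) z (F G : End_TM M -> W) u :
  extends_at Q z F G -> tangent_Z Q z u ->
  d_Z Q z F u = 'D_u (G \o E_point z.1) (E_coord z.1 z).
Proof.
move=> FG [c [c0 cZ csm cu]].
have dc := smooth_near_differentiable csm.
have curve G' : extends_at Q z F G' ->
    'D_u (G' \o E_point z.1) (E_coord z.1 z) = 'D_(1 : R^o) (F \o c : R^o -> W) 0.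
  move=> [sG GF]; have dG := smooth_near_differentiable sG.
  pose g (t : R^o) := E_coord z.1 (c t).
  have g0 : g 0 = E_coord z.1 z by rewrite /g c0.
  rewrite -g0 in dG; have gD := derive_comp (1 : R^o) dc dG.
  rewrite -cu -g0 -gD.
  apply: near_eq_derive; apply: filterS cZ => t [ct dt].
  by rewrite /= (E_pointK dt); exact: GF.
by rewrite /d_Z (curve _ FG); apply: curve; apply: xgetPex; exists G.
Qed.
End Coordinates.

Section Twistor.
Variables (R : realType) (m : nat) (M : manifold R m).
Variable Q : M -> set 'M[R]_m.
Hypotheses (m_gt0 : (0 < m)%N) (Q_bundle : quaternionic_subbundle Q).
Implicit Types (p q : M) (z : End_TM M) (X : 'cV[R]_m).
Hint Resolve chart_self : core.

Definition frame_at p (J1 J2 J3 : M -> 'M[R]_m) :=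
  [/\ smooth_end p J1, smooth_end p J2, smooth_end p J3
    & \forall q \near p, admissible (J1 q) (J2 q) (J3 q) /\
        forall A, Q q A <-> exists a b c, A = quat (J1 q) (J2 q) (J3 q) a b c].

Lemma frame_exists p : exists J1 J2 J3, frame_at p J1 J2 J3.
Proof.
have [J1 [J2 [J3 [s1 s2 s3 H]]]] := Q_bundle p.
by exists J1, J2, J3; split => //; apply: filterS H => q [adm ->].
Qed.

Section Frame.
Variables (p : M) (J1 J2 J3 : M -> 'M[R]_m).
Hypothesis J_frame : frame_at p J1 J2 J3.
Definition frame_quat a b c q := quat (J1 q) (J2 q) (J3 q) a b c.

Lemma frame_self : admissible (J1 p) (J2 p) (J3 p) /\
  forall A, Q p A <-> exists a b c, A = frame_quat a b c p.
Proof. by case: J_frame => _ _ _ /nbhs_singleton. Qed.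

Lemma smooth_frame_quat a b c : smooth_end p (frame_quat a b c).
Proof.
have [s1 s2 s3 _] := J_frame.
have sZ (J : M -> 'M[R]_m) (k : R) : smooth_end p J ->
    smooth_near (phi M (chart_at M p) p)
    (fun x => k *: ((fun q => end_coord p q (J q)) \o psi M (chart_at M p)) x).
  by move=> sJ; apply: smooth_near_scale sJ; exact: smooth_near_cst.
apply: smooth_near_eq (smooth_nearD (smooth_nearD (sZ _ a s1) (sZ _ b s2)) (sZ _ c s3)).
by near=> x; rewrite /= end_coord_quat.
Unshelve. all: by end_near. Qed.

Lemma near_frame_quat a b c : \forall q \near p, Q q (frame_quat a b c q).
Proof.
have [_ _ _ H] := J_frame; apply: filterS H => q [_ QE].
by apply/QE; exists a, b, c.
Qed.

Lemma Q_quat_sub A B : Q p A -> Q p B -> forall k, Q p (A + k *: B).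
Proof.
have [_ QE] := frame_self.
move=> /QE[a [b [c ->]]] /QE[d [e [f ->]]] k; apply/QE.
exists (a + k * d), (b + k * e), (c + k * f).
by apply/matrixP => i j; rewrite !mxE; ring.
Qed.

(** Extend the quaternion to a local section of [Q] with constant coefficients in the frame: both
    its covariant derivatives lie in [Q], and they differ by the commutator with the difference
    tensor. *)
Lemma conn_diff_stable (D D' : covariant_derivative M) :
  linear_connection D -> linear_connection D' ->
  preserves D Q -> preserves D' Q ->
  stable_span (conn_diff D D' p) (J1 p) (J2 p) (J3 p).
Proof.
move=> lD lD' pD pD' X a b c; have [_ QE] := frame_self.
apply/QE; have sA := smooth_frame_quat a b c.
have := pD' p X _ sA (near_frame_quat a b c).
have := pD p X _ sA (near_frame_quat a b c).
rewrite !cov_endE// (cov_coord_diff D D') => Q1 Q2.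
have := Q_quat_sub Q2 Q1 (-1); rewrite scaleN1r addrAC subrr add0r.
by [].
Qed.

Variable D : covariant_derivative M.
Hypotheses (D_conn : linear_connection D) (D_Q : preserves D Q).

Definition coord_end (A : M -> 'M[R]_m) : 'cV[R]_m -> 'M[R]_m :=
  (fun q => end_coord p q (A q)) \o psi M (chart_at M p).
Local Notation x0 := (phi M (chart_at M p) p).

Lemma coord_end_self A : coord_end A x0 = A p.
Proof. by rewrite /coord_end /= psi_phi_self end_coord_id. Qed.

Lemma cov_frame_quat X a b c :
  Q p (cov_coord D p X (frame_quat a b c p) ('D_X (coord_end (frame_quat a b c)) x0)).
Proof.
have sA := smooth_frame_quat a b c.
by rewrite -cov_endE//; apply: D_Q => //; exact: near_frame_quat.
Qed.
End Frame.

(** The product topology of [End_TM] is not the right one, so continuity of the base point comes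
    from the coordinates of the curve. *)
Lemma curve_near z (c : R -> End_TM M) (P : M -> Prop) :
  c 0 = z ->
  (\forall t \near (0 : R), dom M (chart_at M z.1) (c t).1) ->
  differentiable (fun t : R^o => E_coord z.1 (c t)) (0 : R^o) ->
  (\forall q \near z.1, P q) -> \forall t \near (0 : R), P (c t).1.
Proof.
move=> c0 cd cdiff Pz.
have cc : {for (0 : R^o), continuous (fun t : R^o => (E_coord z.1 (c t)).1)}.
  apply: (@continuous_comp _ _ _ (fun t : R^o => E_coord z.1 (c t)) fst).
    exact: differentiable_continuous.
  exact: cvg_fst.
have H : \forall x \near (E_coord z.1 (c 0)).1, P (psi M (chart_at M z.1) x).
  by rewrite c0; exact: near_coord.
have H' : \forall t \near (0 : R), P (psi M (chart_at M z.1) (E_coord z.1 (c t)).1).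
  exact: (cc _ H).
apply: filterS2 H' cd => t Pt dt.
by rewrite -(phiK dt).
Qed.

Lemma qdot_mxcomm_self T (A : 'M[R]_m) : qdot A (mxcomm T A) = 0.
Proof. by have := qdot_mxcomm T A A; rewrite qdotC; lra. Qed.

(** The Leibniz rule along a frame. The right-hand side starts from [0] and is bracketed to match
    the later iteration of [Q_quat_sub]. *)
Lemma cov_coord_comb (D : covariant_derivative M) p X (a b c a' b' c' : R)
    (A1 A2 A3 B1 B2 B3 : 'M[R]_m) :
  cov_coord D p X (a *: A1 + b *: A2 + c *: A3)
    (a' *: A1 + a *: B1 + (b' *: A2 + b *: B2) + (c' *: A3 + c *: B3))
  = 0 + a' *: A1 + b' *: A2 + c' *: A3 + a *: cov_coord D p X A1 B1
    + b *: cov_coord D p X A2 B2 + c *: cov_coord D p X A3 B3.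
Proof.
rewrite /cov_coord !mulmxDl !mulmxDr -!scalemxAl -!scalemxAr.
set G := christoffel D p X.
move: (G *m A1) (G *m A2) (G *m A3) (A1 *m G) (A2 *m G) (A3 *m G).
by move=> m1 m2 m3 m4 m5 m6; apply/matrixP => i j; rewrite !mxE; ring.
Qed.

(** Let [u] be the velocity of a curve [(p(t), J(t))] in [Z]. Differentiating [|J(t)|^2 = 1] gives
    orthogonality to [J], since the commutator with the Christoffel matrix is orthogonal to [J] by
    itself. For membership in [Q], expand [J(t)] in a frame along the curve: by the Leibniz rule the
    result combines the frame and its covariant derivatives, which all lie in [Q]. *)
Lemma vertical_Theta (D : covariant_derivative M) z u :
  linear_connection D -> preserves D Q ->
  twistor Q z -> tangent_Z Q z u -> Theta Q z (vertical D z u).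
Proof.
move=> lD pD [Qz nz] [c [c0 cZ csm cu]].
have [J1 [J2 [J3 Jf]]] := frame_exists z.1.
have [s1 s2 s3 Jn] := Jf.
pose x0 := phi M (chart_at M z.1) z.1.
have dc := smooth_near_differentiable csm.
pose x (t : R^o) := (E_coord z.1 (c t)).1.
pose B (t : R^o) := (E_coord z.1 (c t)).2.
have x00 : x 0 = x0 by rewrite /x c0 E_coord_self.
have B0 : B 0 = z.2 by rewrite /B c0 E_coord_self.
have dx : differentiable x 0.
  apply: smooth_near_differentiable.
  exact: smooth_near_linear (@fst_linear _ _ _) (@fst_continuous _ _ _) csm.
have dB : differentiable B 0.
  apply: smooth_near_differentiable.
  exact: smooth_near_linear (@snd_linear _ _ _) (@snd_continuous _ _ _) csm.
have Dx : 'D_(1 : R^o) x 0 = u.1 by rewrite (derive_fst _ dc) cu.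
have DB : 'D_(1 : R^o) B 0 = u.2 by rewrite (derive_snd _ dc) cu.
have cdom : \forall t \near (0 : R), dom M (chart_at M z.1) (c t).1.
  by apply: filterS cZ => t [].
have nJ := curve_near c0 cdom dc Jn.
split; last first.
  rewrite /vertical /cov_coord -[X in _ + X]/(mxcomm _ _) qdotDr qdot_mxcomm_self addr0.
  have [_ DBB] := derive_qdot (1 : R^o) dB dB.
  have : 'D_(1 : R^o) (fun t : R^o => qdot (B t) (B t) : R^o) 0 = 0.
    rewrite (@near_eq_derive _ _ _ _ (fun=> 1 : R^o)); first exact: derive_cst.
    apply: filterS cZ => t [[_ nt] dt].
    by rewrite /B /= qdot_end_coord.
  by rewrite DBB DB B0 (qdotC u.2); lra.
pose K (J : M -> 'M[R]_m) := @coord_end z.1 J.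
(* The frame is orthonormal, so these scalar products are the coefficients of [B t] in it. Written
   this way they are differentiable in [t], which the coefficients provided pointwise by membership
   in [Q] do not show. *)
pose a (J : M -> 'M[R]_m) (t : R^o) : R^o := qdot (K J (x t)) (B t).
have dK J : smooth_end z.1 J -> differentiable (K J \o x) (0 : R^o).
  move=> sJ; apply: differentiable_comp => //; rewrite x00.
  exact: smooth_near_differentiable sJ.
have DK J : smooth_end z.1 J -> 'D_(1 : R^o) (K J \o x) 0 = 'D_(u.1) (K J) x0.
  move=> sJ; rewrite derive_comp ?Dx ?x00//.
  exact: smooth_near_differentiable sJ.
have da J : smooth_end z.1 J -> differentiable (a J) (0 : R^o).
  by move=> sJ; have [] := derive_qdot (1 : R^o) (dK J sJ) dB.
pose F J (t : R^o) := a J t *: (K J \o x) t.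
have dF J : smooth_end z.1 J -> differentiable (F J) (0 : R^o).
  by move=> sJ; apply: differentiable_scale; [exact: da|exact: dK].
have DF J : smooth_end z.1 J -> 'D_(1 : R^o) (F J) 0 =
    'D_(1 : R^o) (a J) 0 *: J z.1 + a J 0 *: 'D_(u.1) (K J) x0.
  move=> sJ; rewrite derive_scale ?DK//; [|exact: da|exact: dK].
  by rewrite /= x00 /K coord_end_self.
have BE : \forall t \near (0 : R^o), B t = (F J1 + F J2 + F J3) t.
  near=> t; have [adm QE] : admissible (J1 (c t).1) (J2 (c t).1) (J3 (c t).1) /\
      (forall A, Q (c t).1 A <->
        exists a b c', A = quat (J1 (c t).1) (J2 (c t).1) (J3 (c t).1) a b c').
    by near: t.
  have [[Qt _] dt] : twistor Q (c t) /\ dom M (chart_at M z.1) (c t).1 by near: t.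
  have [d [e [f cE]]] := (QE _).1 Qt.
  have KE J : (K J \o x) t = end_coord z.1 (c t).1 (J (c t).1).
    by rewrite /K /coord_end /x /= phiK.
  have aE J : a J t = qdot (J (c t).1) (c t).2.
    by rewrite /a -[K J (x t)]/((K J \o x) t) KE /B qdot_end_coord.
  rewrite -[RHS]/(a J1 t *: (K J1 \o x) t + a J2 t *: (K J2 \o x) t
    + a J3 t *: (K J3 \o x) t).
  rewrite !KE !aE -[RHS]/(quat _ _ _ _ _ _) -end_coord_quat /B /=.
  congr (end_coord _ _ _).
  have J1E : J1 (c t).1 = quat (J1 (c t).1) (J2 (c t).1) (J3 (c t).1) 1 0 0.
    by rewrite /quat scale1r !scale0r !addr0.
  have J2E : J2 (c t).1 = quat (J1 (c t).1) (J2 (c t).1) (J3 (c t).1) 0 1 0.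
    by rewrite /quat scale1r !scale0r addr0 add0r.
  have J3E : J3 (c t).1 = quat (J1 (c t).1) (J2 (c t).1) (J3 (c t).1) 0 0 1.
    by rewrite /quat scale1r !scale0r !add0r.
  rewrite [LHS]cE; congr quat; rewrite cE.
  - by rewrite [X in qdot X _]J1E qdot_quat//; ring.
  - by rewrite [X in qdot X _]J2E qdot_quat//; ring.
  - by rewrite [X in qdot X _]J3E qdot_quat//; ring.
have u2E : u.2 = 'D_(1 : R^o) (F J1) 0 + 'D_(1 : R^o) (F J2) 0 + 'D_(1 : R^o) (F J3) 0.
  rewrite -DB (near_eq_derive _ BE).
  have dd J : smooth_end z.1 J -> derivable (F J) 0 (1 : R^o).
    by move=> sJ; apply: diff_derivable; exact: dF.
  have [d1 d2 d3] := And3 (dd _ s1) (dd _ s2) (dd _ s3).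
  by rewrite (deriveD (derivableD d1 d2) d3) (deriveD d1 d2).
have z2E : z.2 = a J1 0 *: J1 z.1 + a J2 0 *: J2 z.1 + a J3 0 *: J3 z.1.
  rewrite -B0 (nbhs_singleton BE).
  rewrite -[LHS]/(a J1 0 *: K J1 (x 0) + a J2 0 *: K J2 (x 0) + a J3 0 *: K J3 (x 0)).
  by rewrite x00 /K !coord_end_self.
have f1 : frame_quat J1 J2 J3 1 0 0 = J1.
  by apply/funext => q; rewrite /frame_quat /quat scale1r !scale0r !addr0.
have f2 : frame_quat J1 J2 J3 0 1 0 = J2.
  by apply/funext => q; rewrite /frame_quat /quat scale1r !scale0r addr0 add0r.
have f3 : frame_quat J1 J2 J3 0 0 1 = J3.
  by apply/funext => q; rewrite /frame_quat /quat scale1r !scale0r !add0r.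
have QJ d e f := nbhs_singleton (near_frame_quat Jf d e f).
have [q1 q2 q3] := And3 (QJ 1 0 0) (QJ 0 1 0) (QJ 0 0 1).
have cQ := cov_frame_quat Jf lD pD u.1.
have [c1 c2 c3] := And3 (cQ 1 0 0) (cQ 0 1 0) (cQ 0 0 1).
rewrite f1 f2 f3 in q1 q2 q3 c1 c2 c3.
have Q0 : Q z.1 0 by have := Q_quat_sub Jf q1 q1 (-1); rewrite scaleN1r subrr.
have comb A B' k : Q z.1 A -> Q z.1 B' -> Q z.1 (A + k *: B').
  by move=> QA QB; exact: (Q_quat_sub Jf).
have := comb _ _ (a J3 0) (comb _ _ (a J2 0) (comb _ _ (a J1 0)
  (comb _ _ ('D_(1 : R^o) (a J3) 0) (comb _ _ ('D_(1 : R^o) (a J2) 0)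
  (comb _ _ ('D_(1 : R^o) (a J1) 0) Q0 q1) q2) q3) c1) c2) c3.
by congr (Q _ _); rewrite /vertical u2E z2E !DF// cov_coord_comb.
Unshelve. all: by end_near. Qed.

End Twistor.

(** * Curves in the twistor space with prescribed velocity *)

Section TangentZ.
Variable R : realType.

Lemma smooth_near_id (V : normedModType R) (x : V) : smooth_near x (id : V -> V).
Proof. by exists setT; [split => //; exact: openT|move=> k; exact: Ck_id]. Qed.

(** The rational parametrization of [x^2 + r y^2 = 1] by stereographic projection: with
    [s = r t^2 / 4], [k1 = (1 - s) / (1 + s)] and [k2 = t / (1 + s)]. It covers [r = 0] as well,
    with no square root of [r] to divide by. *)
Lemma circle_param (r : R) : 0 <= r -> exists k1 k2 : R^o -> R^o,
  [/\ smooth_near 0 k1, smooth_near 0 k2, k1 0 = 1 /\ k2 0 = 0,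
      'D_(1 : R^o) k1 0 = 0 /\ 'D_(1 : R^o) k2 0 = 1
    & forall t, k1 t * k1 t + r * (k2 t * k2 t) = 1].
Proof.
move=> r0; pose s (t : R^o) : R^o := (r / 4) *: (t *: t).
have s_ge0 t : 0 <= s t.
  by rewrite -[s t]/(r / 4 * (t * t)) mulr_ge0 ?divr_ge0// -expr2 sqr_ge0.
pose P (t : R^o) : R^o := 1 + s t.
have P0 t : P t != 0 by rewrite gt_eqF// /P ltr_wpDr.
have sid : smooth_near (0 : R^o) (id : R^o -> R^o) by exact: smooth_near_id.
have ss : smooth_near (0 : R^o) s.
  apply: smooth_near_scale; first exact: smooth_near_cst.
  exact: smooth_near_scale.
have sP : smooth_near (0 : R^o) P by apply: smooth_nearD ss; exact: smooth_near_cst.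
pose k (t : R^o) : R^o := (P t)^-1.
have sk : smooth_near (0 : R^o) k by exact: smooth_near_inv.
pose k1 (t : R^o) : R^o := -1 + (2 : R^o) *: k t.
pose k2 (t : R^o) : R^o := k t *: t.
have s2k : smooth_near (0 : R^o) (fun t => (2 : R^o) *: k t : R^o).
  by apply: smooth_near_scale sk; exact: smooth_near_cst.
have sk1 : smooth_near (0 : R^o) k1 by apply: smooth_nearD s2k; exact: smooth_near_cst.
have sk2 : smooth_near (0 : R^o) k2 by exact: smooth_near_scale.
have s00 : s 0 = 0 by rewrite /s !scaler0.
have k00 : k 0 = 1 by rewrite /k /P s00 addr0 invr1.
have k10 : k1 0 = 1 by rewrite /k1 k00 [_ *: _]mulr1; lra.
have k20 : k2 0 = 0 by rewrite /k2 scaler0.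
have rel t : k1 t * k1 t + r * (k2 t * k2 t) = 1.
  have tt : r * (t * t) = 4 * (P t - 1).
    by rewrite /P /s -[_ *: (_ *: _)]/(r / 4 * (t * t)); lra.
  have kP : k t * P t = 1 by rewrite /k mulVf.
  rewrite /k1 /k2 -[2 *: _]/(2 * k t) -[_ *: _]/(k t * t).
  have -> : r * (k t * t * (k t * t)) = k t * k t * (r * (t * t)) by ring.
  rewrite tt.
  have -> : k t * k t * (4 * (P t - 1)) = 4 * (k t * (k t * P t) - k t * k t) by ring.
  by rewrite kP; ring.
exists k1, k2; split => //; split; last first.
  rewrite derive_scale; [|exact: smooth_near_differentiable sk|exact: smooth_near_differentiable sid].
  by rewrite derive_id scaler0 add0r k00 scale1r.
have d1 := smooth_near_differentiable sk1; have d2 := smooth_near_differentiable sk2.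
have d11 := smooth_near_differentiable (smooth_near_scale sk1 sk1).
have d22 := smooth_near_differentiable (smooth_near_scale sk2 sk2).
have dr := smooth_near_differentiable (smooth_near_cst (r : R^o) (0 : R^o)).
have dr22 := differentiable_scale dr d22.
(* The derivative of [k1] at 0 is read off by differentiating the relation, where [k1 = 1] and
   [k2 = 0]. *)
have := @derive_cst _ _ _ (1 : R^o) (0 : R^o) (1 : R^o).
rewrite (_ : cst 1 = (fun t => k1 t *: k1 t) + (fun t => (r : R^o) *: (k2 t *: k2 t))).
  rewrite (deriveD (diff_derivable d11) (diff_derivable dr22)).
  rewrite (derive_scale _ dr d22) (derive_scale _ d1 d1) (derive_scale _ d2 d2).
  rewrite k10 k20 derive_cst !(scaler0, scale0r, add0r, addr0) scale1r [_ *: 1]mulr1.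
  by lra.
by apply/funext => t; rewrite -[RHS]/(k1 t * k1 t + r * (k2 t * k2 t)) rel.
Qed.

Variables (m : nat) (M : manifold R m) (Q : M -> set 'M[R]_m).
Hypotheses (m_gt0 : (0 < m)%N) (Q_bundle : quaternionic_subbundle Q).
Variable D : covariant_derivative M.
Hypotheses (D_conn : linear_connection D) (D_Q : preserves D Q).
Implicit Types (p q : M) (z : End_TM M) (X : 'cV[R]_m).
Hint Resolve chart_self : core.

Lemma qdot_circle (J1 J2 J3 : 'M[R]_m) a b c d e f (k l : R) :
  admissible J1 J2 J3 -> a * a + b * b + c * c = 1 -> a * d + b * e + c * f = 0 ->
  k * k + (d * d + e * e + f * f) * (l * l) = 1 ->
  let A := quat J1 J2 J3 (k * a + l * d) (k * b + l * e) (k * c + l * f) in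
  qdot A A = 1.
Proof.
move=> adm n1 n0 <-; rewrite /= qdot_quat//.
transitivity (k * k * (a * a + b * b + c * c)
  + 2 * k * l * (a * d + b * e + c * f) + (d * d + e * e + f * f) * (l * l)).
  by ring.
by rewrite n1 n0 mulr0 addr0 mulr1.
Qed.

(** The base point moves on a straight line of the chart with velocity [X]. The fibre part starts
    from the section through [z.2] with constant coefficients in a frame, whose covariant derivative
    along [X] is [C], and rotates it towards the section through [A - C]. As [A - C] is orthogonal
    to [z.2], [circle_param] keeps the norm 1 and adds the velocity [A - C], so the vertical
    velocity is [A]. *)
Lemma tangent_of_split z X A :
  twistor Q z -> Theta Q z A -> tangent_Z Q z (of_split D z X A).
Proof.
move=> [Qz nz] [QA nA].
have [J1 [J2 [J3 Jf]]] := frame_exists Q_bundle z.1.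
have [_ _ _ Jn] := Jf.
have [adm QE] := frame_self Jf.
pose fq := frame_quat J1 J2 J3.
pose ph := phi M (chart_at M z.1); pose ps := psi M (chart_at M z.1).
pose x0 := ph z.1.
have [a [b [c zE]]] := (QE _).1 Qz.
have nabc : a * a + b * b + c * c = 1.
  by move: nz; rewrite zE qdot_quat.
pose K d e f := coord_end z.1 (fq d e f).
have sK d e f : smooth_near x0 (K d e f) by exact: (smooth_frame_quat Jf).
have dK d e f : differentiable (K d e f) x0 := smooth_near_differentiable (sK d e f).
have K0 d e f : K d e f x0 = fq d e f z.1 by exact: coord_end_self.
have near_fr : \forall x \near x0, dom M (chart_at M z.1) (ps x) /\
    (admissible (J1 (ps x)) (J2 (ps x)) (J3 (ps x)) /\
     forall A', Q (ps x) A' <->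
       exists a b c, A' = quat (J1 (ps x)) (J2 (ps x)) (J3 (ps x)) a b c).
  by apply: filterS2 (near_coord (near_self_dom z.1)) (near_coord Jn).
have qK d e f d' e' f' : \forall x \near x0,
    qdot (K d e f x) (K d' e' f' x) = d * d' + e * e' + f * f'.
  apply: filterS near_fr => x [xd [xadm _]].
  by rewrite /K /coord_end /= qdot_end_coord// qdot_quat.
pose C := cov_coord D z.1 X z.2 ('D_X (K a b c) x0).
have QC : Q z.1 C by rewrite /C zE; exact: cov_frame_quat.
have nC : qdot z.2 C = 0.
  rewrite /C /cov_coord -[X in _ + X]/(mxcomm _ _) qdotDr qdot_mxcomm_self addr0.
  have [_ DKK] := derive_qdot X (dK a b c) (dK a b c).
  have : 'D_X (fun x => qdot (K a b c x) (K a b c x) : R^o) x0 = 0.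
    rewrite (near_eq_derive _ (qK a b c a b c)); exact: derive_cst.
  by rewrite DKK K0 -/fq -[fq _ _ _ _]zE (qdotC _ z.2); lra.
have QB : Q z.1 (A - C).
  by rewrite -scaleN1r; exact: (Q_quat_sub Jf).
have [d [e [f BE]]] := (QE _).1 QB.
have nB : a * d + b * e + c * f = 0.
  have : qdot z.2 (A - C) = 0 by rewrite qdotDr qdotNr nC nA subr0.
  by rewrite BE zE qdot_quat.
pose r := d * d + e * e + f * f.
have r0 : 0 <= r by rewrite /r -!expr2 !addr_ge0// sqr_ge0.
have [k1 [k2 [sk1 sk2 [k10 k20] [Dk1 Dk2] kr]]] := circle_param r0.
pose l (t : R^o) : 'cV[R]_m := t *: X.
have l_lin : linear l by move=> k s t; rewrite /l scalerDl scalerA.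
have l_c : continuous l by exact: scalel_continuous.
pose x (t : R^o) : 'cV[R]_m := x0 + l t.
have xc : continuous x by move=> t; apply: cvgD; [exact: cvg_cst|exact: l_c].
have x00 : x 0 = x0 by rewrite /x /l scale0r addr0.
pose cu t : End_TM M :=
  (ps (x t), k1 t *: fq a b c (ps (x t)) + k2 t *: fq d e f (ps (x t))).
pose G (t : R^o) := k1 t *: K a b c (x t) + k2 t *: K d e f (x t).
have sKx d' e' f' : smooth_near (0 : R^o) (fun t => K d' e' f' (x t)).
  apply: smooth_near_affine => //; rewrite -/(x 0) x00; exact: sK.
have sx : smooth_near (0 : R^o) x.
  by apply: (smooth_near_affine (f := id)) => //; exact: smooth_near_id.
have sG1 := smooth_near_scale sk1 (sKx a b c).
have sG2 := smooth_near_scale sk2 (sKx d e f).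
have sG : smooth_near (0 : R^o) G := smooth_nearD sG1 sG2.
have near_x (P : 'cV[R]_m -> Prop) : (\forall y \near x0, P y) ->
    \forall t \near (0 : R^o), P (x t).
  by move=> Px; have := xc 0; apply; rewrite x00.
have x_img : \forall t \near (0 : R^o), (ph @` dom M (chart_at M z.1)) (x t).
  by apply: near_x; exact: near_img.
have gE : \forall t \near (0 : R^o), (x t, G t) = E_coord z.1 (cu t).
  apply: filterS x_img => t xt.
  rewrite /E_coord /cu [X in _ = (X, _)](phi_psi xt); congr (_, _).
  by rewrite end_coordD !end_coordZ.
have dG := smooth_near_differentiable sG.
have dx := smooth_near_differentiable sx.
have Dx : 'D_(1 : R^o) x 0 = X.
  have [dl lE] := linear_diff (0 : R^o) l_lin l_c.
  rewrite [LHS](@deriveD _ _ _ (cst x0) l _ _ (derivable_cst _ _ _) (diff_derivable dl)).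
  by rewrite derive_cst add0r deriveE// lE /l scale1r.
have DK : 'D_(1 : R^o) (fun t => K a b c (x t)) 0 = 'D_X (K a b c) x0.
  have dKx : differentiable (K a b c) (x 0) by rewrite x00.
  by have := derive_comp (1 : R^o) dx dKx; rewrite Dx x00.
have DG : 'D_(1 : R^o) G 0 = 'D_X (K a b c) x0 + (A - C).
  have d1 := smooth_near_differentiable sk1; have d2 := smooth_near_differentiable sk2.
  have d3 := smooth_near_differentiable (sKx a b c).
  have d4 := smooth_near_differentiable (sKx d e f).
  have e1 := differentiable_scale d1 d3; have e2 := differentiable_scale d2 d4.
  rewrite [LHS](deriveD (diff_derivable e1) (diff_derivable e2)).
  rewrite (derive_scale _ d1 d3) (derive_scale _ d2 d4) Dk1 Dk2 k10 k20 DK.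
  by rewrite !scale0r !scale1r add0r addr0 x00 K0 BE.
exists cu; split.
- rewrite /cu x00 /ps /x0 /ph psi_phi_self k10 k20 scale1r scale0r addr0 -/fq.
  by rewrite -[fq _ _ _ _]zE -surjective_pairing.
- apply: filterS (near_x _ near_fr) => t [td [tadm tQ]].
  have cuE : (cu t).2 = quat (J1 (ps (x t))) (J2 (ps (x t))) (J3 (ps (x t)))
      (k1 t * a + k2 t * d) (k1 t * b + k2 t * e) (k1 t * c + k2 t * f).
    by rewrite /cu /fq /frame_quat /quat /=; apply/matrixP => i j; rewrite !mxE; ring.
  split; last exact: td.
  split; first by apply/tQ; rewrite cuE; do 3 eexists.
  by rewrite cuE; exact: (qdot_circle tadm nabc nB (kr t)).
- by apply: smooth_near_eq gE _; exact: smooth_near_pair.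
- rewrite -(near_eq_derive _ gE).
  pose g (t : R^o) := (x t, G t).
  have dg : differentiable g 0.
    exact: smooth_near_differentiable (smooth_near_pair sx sG).
  have e1 : ('D_(1 : R^o) g 0).1 = X by rewrite -(derive_fst _ dg).
  have e2 : ('D_(1 : R^o) g 0).2 = 'D_X (K a b c) x0 + (A - C).
    by rewrite -(derive_snd _ dg).
  rewrite -/g [LHS]surjective_pairing e1 e2 /of_split /C /cov_coord.
  by rewrite opprD addrCA; congr (_, A + _); rewrite addrA subrr add0r.
Qed.

Lemma Theta_mul z A : twistor Q z -> Theta Q z A -> Theta Q z (z.2 *m A).
Proof.
move=> [Qz nz] [QA nA].
have [J1 [J2 [J3 Jf]]] := frame_exists Q_bundle z.1.
have [adm QE] := frame_self Jf.
have [a [b [c zE]]] := (QE _).1 Qz; have [d [e [f AE]]] := (QE _).1 QA.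
have zA : a * d + b * e + c * f = 0 by move: nA; rewrite zE AE qdot_quat.
rewrite /Theta /= zE AE (quat_mul adm) zA oppr0 raddf0 add0r; split.
  by apply/QE; do 3 eexists.
by rewrite qdot_quat//; ring.
Qed.

Lemma twistor_sqr z : twistor Q z -> z.2 *m z.2 = (-1)%:M.
Proof.
move=> [Qz nz]; have [J1 [J2 [J3 Jf]]] := frame_exists Q_bundle z.1.
have [adm QE] := frame_self Jf; have [a [b [c zE]]] := (QE _).1 Qz.
have nabc : a * a + b * b + c * c = 1 by move: nz; rewrite zE qdot_quat.
rewrite zE (quat_mul adm) nabc (mulrC c b) (mulrC a c) (mulrC b a) !subrr.
by rewrite /quat !scale0r !addr0.
Qed.

(** Needed because [dbar] differentiates along [cplx_Z D z u] too, and [d_Z] is controlled on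
    tangent vectors only. *)
Lemma tangent_cplx z u :
  twistor Q z -> tangent_Z Q z u -> tangent_Z Q z (cplx_Z D z u).
Proof.
move=> Zz uT; apply: tangent_of_split => //; apply: Theta_mul => //.
exact: (vertical_Theta m_gt0 Q_bundle).
Qed.
End TangentZ.

(** The square gives access to the logarithmic derivative of [f] whatever its sign. *)
Lemma smooth_near_ln_sqr (R : realType) (V : normedModType R) (f : V -> R^o) x v :
  smooth_near x f -> f x != 0 ->
  smooth_near x (fun y => ln (f y * f y) : R^o) /\
  'D_v (fun y => ln (f y * f y) : R^o) x = 2 * ('D_v f x / f x).
Proof.
move=> sf fx; have f2 : 0 < f x * f x by rewrite -expr2 exprn_even_gt0.
have sff := smooth_near_scale sf sf.
split; first exact: smooth_near_ln.
have df := smooth_near_differentiable sf.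
have dff := smooth_near_differentiable sff.
have [_ E] := derive_comp1 v dff (is_derive1_ln f2).
rewrite [LHS]E (derive_scale _ df df).
rewrite -[X in _ * X]/('D_v f x * f x + f x * 'D_v f x).
by field.
Qed.

(** * Comparison of two connections *)

Section TwoConnections.
Variables (R : realType) (m : nat) (M : manifold R m) (Q : M -> set 'M[R]_m).
Hypotheses (m_gt0 : (0 < m)%N) (m_neq2 : m != 2%N).
Hypothesis Q_bundle : quaternionic_subbundle Q.
Variables D D' : covariant_derivative M.
Hypotheses (D_quat : quaternionic_connection Q D).
Hypotheses (D'_quat : quaternionic_connection Q D').
Implicit Types (p q : M) (z : End_TM M) (X : 'cV[R]_m).

Let S p := conn_diff D D' p.
Let al p := prolongation_form (S p).

Lemma conn_diff_quat p : exists J1 J2 J3,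
  [/\ admissible J1 J2 J3, stable_span (S p) J1 J2 J3, linear (S p),
      forall X Y, S p X *m Y = S p Y *m X
    & forall A, Q p A <-> exists a b c, A = quat J1 J2 J3 a b c].
Proof.
have [lD tD pD] := D_quat; have [lD' tD' pD'] := D'_quat.
have [J1 [J2 [J3 Jf]]] := frame_exists Q_bundle p.
have [adm QE] := frame_self Jf.
exists (J1 p), (J2 p), (J3 p); split => //.
- exact: (conn_diff_stable Jf).
- exact: conn_diff_linear.
- by move=> X Y; exact: conn_diff_sym.
Qed.

Lemma christoffel_diff p X : christoffel D' p X = christoffel D p X + S p X.
Proof. by rewrite /S /conn_diff addrC subrK. Qed.

(** The vertical part and the horizontal lift both change by commutators with the difference tensor;
    after multiplication of the first by [J], [prolongation_hor] makes the two changes cancel. *)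
Lemma cplx_Z_indep z u : twistor Q z -> cplx_Z D' z u = cplx_Z D z u.
Proof.
move=> [Qz nz].
have [J1 [J2 [J3 [adm st lS symS QE]]]] := conn_diff_quat z.1.
have := prolongation_hor m_gt0 lS symS u.1 m_neq2 adm st ((QE _).1 Qz).
rewrite /cplx_Z /of_split /vertical (cov_coord_diff D D') christoffel_diff -/S.
move=> JS; congr (_, _); rewrite mulmxDr JS /mxcomm {JS}.
move: (S z.1 (z.2 *m u.1)) (christoffel D z.1 (z.2 *m u.1)) => T G.
move: (z.2 *m cov_coord D z.1 u.1 z.2 u.2) => a1; rewrite mulmxDl mulmxDr.
move: (T *m z.2) (z.2 *m T) (G *m z.2) (z.2 *m G) => a2 a3 a4 a5.
by apply/matrixP => i j; rewrite !mxE; ring.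
Qed.

Lemma proj_ThetaD z A B : proj_Theta z (A + B) = proj_Theta z A + proj_Theta z B.
Proof. by rewrite /proj_Theta qdotDr scalerDl opprD addrACA. Qed.

Lemma proj_ThetaZ z a A : proj_Theta z (a *: A) = a *: proj_Theta z A.
Proof. by rewrite /proj_Theta qdotZr scalerBr scalerA. Qed.

Lemma proj_Theta_id z A : Theta Q z A -> proj_Theta z A = A.
Proof. by move=> [_ nA]; rewrite /proj_Theta nA scale0r subr0. Qed.

(** The term [d_Z] is common to both connections, so the difference is the projected commutator
    computed in [prolongation_proj]. *)
Lemma nabla_Theta_diff s z u : twistor Q z -> Theta Q z (s z) ->
  nabla_Theta Q D' s z u = nabla_Theta Q D s z u
    + (- 2 * al z.1 (z.2 *m u.1)) *: (z.2 *m s z).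
Proof.
move=> [Qz nz] [Qs ns].
have [J1 [J2 [J3 [adm st lS symS QE]]]] := conn_diff_quat z.1.
rewrite /nabla_Theta /pullback_conn (cov_coord_diff D D') proj_ThetaD.
congr (_ + _).
exact: (prolongation_proj m_gt0 lS symS _ m_neq2 adm st ((QE _).1 Qz) ((QE _).1 Qs)).
Qed.

Variables w w' : M -> R.
Hypotheses (w_vol : volume_form w) (w'_vol : volume_form w').
Hypotheses (w_D : preserves_form D w) (w'_D' : preserves_form D' w').

(* The squares make the signs of [w] and [w'] irrelevant. *)
Definition log_gauge q : R :=
  (m%:R + 4)^-1 * (ln (w' q * w' q) - ln (w q * w q)).

(** In the chart, [w] and [w'] acquire the same Jacobian determinant, which cancels in the
    difference of logarithms; it is with this factor that volume forms are smooth. Each logarithmic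
    derivative is the trace of a Christoffel matrix, doubled by the square, so the total is
    [2 tr (S X) / (m + 4)]. *)
Lemma log_gaugeP p X : smooth_fun p (log_gauge : M -> R^o) /\
  dirder p X log_gauge = 2 * al p X.
Proof.
have [lD _ _] := D_quat; have [lD' _ _] := D'_quat.
pose x0 := phi M (chart_at M p) p; pose ps := psi M (chart_at M p).
pose W (v : M -> R) q : R := top_form v q (fun j => coord_vf p j q).
have WE v q : W v q = v q * \det (of_coord p q).
  rewrite /W /top_form; congr (_ * \det _).
  by apply/matrixP => a b; rewrite mxE /coord_vf -colE mxE.
have W_p v : W v p = v p by rewrite WE of_coord_id det1 mulr1.
have detN0 q : dom M (chart_at M p) q -> \det (of_coord p q) != 0.
  move=> qd; apply/eqP => d0; have := congr1 determinant (to_coordK qd).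
  by rewrite det_mulmx d0 mulr0 det1 => /eqP; rewrite eq_sym oner_eq0.
pose k : R^o := (m%:R + 4)^-1.
pose L (v : M -> R) (y : 'cV[R]_m) : R^o := ln (W v (ps y) * W v (ps y)).
have hE : \forall y \near x0, k *: (L w' y + (-1 : R^o) *: L w y) = (log_gauge \o ps) y.
  have := near_coord (near_self_dom p); apply: filterS => y yd.
  rewrite /L !WE /log_gauge /=; set d := \det _.
  have d2 : 0 < d * d by rewrite -expr2 exprn_even_gt0//= detN0.
  have v2 v : volume_form v -> 0 < v (ps y) * v (ps y).
    by move=> [v0 _]; rewrite -expr2 exprn_even_gt0//= v0.
  have lnE v : volume_form v -> ln (v (ps y) * d * (v (ps y) * d))
      = ln (v (ps y) * v (ps y)) + ln (d * d).
    by move=> vv; rewrite mulrACA (@lnM _ (_ * _) (d * d))// posrE v2.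
  rewrite !lnE//.
  rewrite -[LHS]/((m%:R + 4)^-1 * (ln (w' (ps y) * w' (ps y)) + ln (d * d)
    + -1 * (ln (w (ps y) * w (ps y)) + ln (d * d)))).
  by ring.
have LP v (E : covariant_derivative M) : volume_form v -> linear_connection E ->
    preserves_form E v ->
    smooth_near x0 (L v) /\ 'D_X (L v) x0 = 2 * \tr (christoffel E p X).
  move=> [v0 sv] lE vE.
  have Wx0 : W v (ps x0) = v p by rewrite /ps /x0 psi_phi_self W_p.
  have W0 : W v (ps x0) != 0 by rewrite Wx0.
  have [sL DL] := smooth_near_ln_sqr X (sv p) W0; split; first exact: sL.
  rewrite [LHS]DL; congr (2 * _).
  rewrite -[X in X / _]/(dirder p X (W v)) (preserves_form_trace p X vE).
  by rewrite -[X in _ / X]/(W v (ps x0)) Wx0 mulrAC divff// mul1r.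
have [sL DL] := LP w D w_vol lD w_D.
have [sL' DL'] := LP w' D' w'_vol lD' w'_D'.
have sc (a : R^o) := smooth_near_cst a x0.
have s1 := smooth_near_scale (sc (-1)) sL.
have s2 := smooth_nearD sL' s1.
have s3 := smooth_near_scale (sc k) s2.
split; first exact: smooth_near_eq hE s3.
rewrite /dirder -(near_eq_derive _ hE).
have [c1 c2] := (smooth_near_differentiable (sc (-1)), smooth_near_differentiable (sc k)).
have [d d'] := (smooth_near_differentiable sL, smooth_near_differentiable sL').
have d1 := smooth_near_differentiable s1.
have d2 := smooth_near_differentiable s2.
rewrite (derive_scale _ c2 d2) derive_cst scale0r add0r.
rewrite (deriveD (diff_derivable d') (diff_derivable d1)) (derive_scale _ c1 d).
rewrite derive_cst scale0r add0r DL DL' /al /prolongation_form /S /conn_diff raddfB /=.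
rewrite -[LHS]/((m%:R + 4)^-1 * (2 * \tr (christoffel D' p X)
  + -1 * (2 * \tr (christoffel D p X)))).
by ring.
Qed.

Definition real_gauge (z : End_TM M) : R[i] := (expR (log_gauge z.1))%:C%C.

Lemma smooth_E_base (W : normedModType R) z (f : M -> W) :
  smooth_fun z.1 f -> smooth_E z (fun y => f y.1).
Proof.
move=> sf; pose f' := f \o psi M (chart_at M z.1).
have := @smooth_near_affine _ _ _ _ f' (fst : 'cV[R]_m * 'M[R]_m -> _) 0 (E_coord z.1 z).
have -> : (fun y : 'cV[R]_m * 'M[R]_m => f' (0 + y.1)) = (fun y => f y.1) \o E_point z.1.
  by apply/funext => y; rewrite add0r.
apply => //; first by move=> y; exact: cvg_fst.
by rewrite add0r.
Qed.

Lemma real_gauge_gauge : gauge Q real_gauge.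
Proof.
move=> z Zz; split.
- by apply/eqP => -[] /eqP; rewrite gt_eqF// expR_gt0.
- have [sh _] := log_gaugeP z.1 0.
  exists (fun y => expR (log_gauge y.1)); split => //.
  by apply: (@smooth_E_base R^o _ (fun q => expR (log_gauge q))); exact: smooth_near_expR.
- exists (fun=> 0); split => //; exact: smooth_near_cst.
Qed.

Lemma cscale_real z (a : R) A : Defs.cscale z (a%:C)%C A = a *: A.
Proof. by rewrite /Defs.cscale /= scale0r addr0. Qed.

Lemma real_gaugeV z : (real_gauge z)^-1 = (expR (- log_gauge z.1))%:C%C.
Proof. by rewrite /real_gauge expRN fmorphV. Qed.

(** Write [h] for [log_gauge]. If [G] extends [s] in coordinates, [exp (- h) G] extends the rescaled
    section, and tangency of [u] allows both differentials to be computed from these extensions. The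
    term [2 al] is [dh]. *)
Lemma d_Z_real_gauge s z u : Theta_section Q s -> twistor Q z -> tangent_Z Q z u ->
  d_Z Q z (fun y => end_coord z.1 y.1 (Defs.cscale y (real_gauge y)^-1 (s y))) u
  = expR (- log_gauge z.1) *:
    (d_Z Q z (fun y => end_coord z.1 y.1 (s y)) u - (2 * al z.1 u.1) *: s z).
Proof.
move=> sT Zz uT; have [_ [G FG]] := sT z Zz.
have [sh dh] := log_gaugeP z.1 u.1.
pose e q : R^o := expR (- log_gauge q).
have sh' : smooth_fun z.1 (fun q => - log_gauge q : R^o).
  apply: (smooth_near_linear (l := fun y : R^o => - y)) sh.
    by move=> k a b; rewrite opprD scalerN.
  by move=> y; exact: opp_continuous.
have se : smooth_fun z.1 e by exact: smooth_near_expR.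
have sE := smooth_E_base se.
have FG2 : extends_at Q z
    (fun y => end_coord z.1 y.1 (Defs.cscale y (real_gauge y)^-1 (s y)))
    (fun y => e y.1 *: G y).
  split; first exact: smooth_near_scale sE FG.1.
  by move=> y Zy; rewrite real_gaugeV cscale_real end_coordZ FG.2.
rewrite (d_ZE FG2 uT) (d_ZE FG uT).
have dG := smooth_near_differentiable FG.1.
have dE := smooth_near_differentiable sE.
rewrite (derive_scale _ dE dG).
have zz : E_point z.1 (E_coord z.1 z) = z by apply: E_pointK; exact: chart_self.
have Gz : (G \o E_point z.1) (E_coord z.1 z) = s z.
  by rewrite /= zz FG.2// end_coord_id.
rewrite Gz -[X in _ + X *: _]/(e (E_point z.1 (E_coord z.1 z)).1) zz.
have [dfst fstE] := linear_diff (E_coord z.1 z) (@fst_linear R 'cV[R]_m 'M[R]_m)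
  (@fst_continuous R 'cV[R]_m 'M[R]_m).
have Dfst : 'D_u (fst : 'cV[R]_m * 'M[R]_m -> _) (E_coord z.1 z) = u.1.
  by rewrite deriveE// fstE.
pose h' := (fun q => - log_gauge q : R^o) \o psi M (chart_at M z.1).
have dh' : differentiable h' (phi M (chart_at M z.1) z.1) := smooth_near_differentiable sh'.
have Dh' : 'D_(u.1) h' (phi M (chart_at M z.1) z.1) = - (2 * al z.1 u.1).
  rewrite -dh /dirder; apply: deriveN; apply: diff_derivable.
  exact: smooth_near_differentiable sh.
have De := derive_comp1 u.1 dh' (is_derive_expR _).
have [de DeE] := De.
have -> : 'D_u ((fun y => e y.1) \o E_point z.1) (E_coord z.1 z)
    = - (2 * al z.1 u.1) * e z.1.
  have := derive_comp u dfst de; rewrite Dfst DeE Dh' => H.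
  rewrite [LHS]H mulrC; congr (_ * expR _).
  by rewrite /h' /= psi_phi_self.
by rewrite scalerBr scalerA -/(e z.1) mulNr scaleNr addrC [_ * e _]mulrC.
Qed.

Lemma al_mul z X : twistor Q z -> al z.1 (z.2 *m (z.2 *m X)) = - al z.1 X.
Proof.
move=> [Qz nz]; have [J1 [J2 [J3 [adm st lS symS QE]]]] := conn_diff_quat z.1.
rewrite mulmxA (twistor_sqr m_gt0 Q_bundle (conj Qz nz)) mul_scalar_mx scaleN1r.
have SN : S z.1 (- X) = - S z.1 X.
  have := lS (-1) X 0; rewrite addr0 !scaleN1r => ->.
  have : S z.1 0 = 0.
    have := lS 1 0 0; rewrite scaler0 addr0 scale1r => /eqP.
    by rewrite -subr_eq0 opprD addNKr oppr_eq0 => /eqP.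
  by move=> ->; rewrite addr0.
by rewrite /al /prolongation_form SN raddfN mulNr.
Qed.

(** Conjugation by [exp h] subtracts [(dh (U) + dh (J U) J) / 2], with [dh = 2 al]. The terms match
    crosswise: the change of [nabla_Theta] at [U] accounts for [dh (J U)], and its change at [J U],
    multiplied by [J], accounts for [dh (U)], by [al (J J U) = - al (U)] and [J J = -1]. *)
Lemma dbar_real_gauge s z u : Theta_section Q s -> twistor Q z -> tangent_Z Q z u ->
  dbar Q D' s z u = Defs.cscale z (real_gauge z)
    (dbar Q D (fun y => Defs.cscale y (real_gauge y)^-1 (s y)) z u).
Proof.
move=> sT Zz uT; have [Ts _] := sT z Zz.
have [lD tD pD] := D_quat.
have cT := tangent_cplx m_gt0 Q_bundle lD pD Zz uT.
have nabE v : tangent_Z Q z v ->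
    nabla_Theta Q D (fun y => Defs.cscale y (real_gauge y)^-1 (s y)) z v
    = expR (- log_gauge z.1) *:
      (nabla_Theta Q D s z v - (2 * al z.1 v.1) *: s z).
  move=> vT; rewrite /nabla_Theta /pullback_conn d_Z_real_gauge//.
  rewrite real_gaugeV cscale_real /cov_coord -scalemxAr -scalemxAl -!scalerBr -scalerDr.
  rewrite proj_ThetaZ; congr (_ *: _).
  rewrite [in LHS]addrAC [LHS]proj_ThetaD -[in LHS]scaleNr.
  by rewrite [X in _ + X]proj_ThetaZ (proj_Theta_id Ts) scaleNr.
have JJ : z.2 *m (z.2 *m s z) = - s z.
  by rewrite mulmxA (twistor_sqr m_gt0 Q_bundle Zz) mul_scalar_mx scaleN1r.
rewrite /dbar !nabla_Theta_diff// cplx_Z_indep// !nabE//.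
rewrite -[(cplx_Z D z u).1]/(z.2 *m u.1) al_mul//.
move: (nabla_Theta Q D s z u) (nabla_Theta Q D s z (cplx_Z D z u)) => N1 N2.
rewrite /real_gauge cscale_real [RHS]scalerA [expR _ * _]mulrC -[RHS]scalerA.
congr (_ *: _).
rewrite -[in RHS]scalemxAr -[in RHS]scalerDr [RHS]scalerA expRN.
rewrite mulfV ?gt_eqF ?expR_gt0// scale1r.
rewrite !mulmxDr mulmxN -!scalemxAr JJ.
move: (z.2 *m N2) (z.2 *m s z) (s z) => A B C.
by apply/matrixP => i j; rewrite !mxE; ring.
Qed.
End TwoConnections.

Theorem corollary4 (R : realType) (n : nat) (n_ge2 : (2 <= n)%N)
    (M : manifold R (4 * n)%N) (M_connected : connected [set: M]%classic)
    (Q : M -> set 'M[R]_(4 * n)%N) (Q_quaternionic : quaternionic_structure Q)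
    (D D' : covariant_derivative M) :
  exact_connection Q D -> exact_connection Q D' ->
  equivalent_structures Q (dbar Q D) (dbar Q D').
Proof.
move=> [qD [w w_vol wD]] [qD' [w' w'_vol w'D']].
have [Q_bundle _] := Q_quaternionic.
have m_gt0 : (0 < 4 * n)%N by rewrite muln_gt0 (leq_trans _ n_ge2).
have m_neq2 : (4 * n)%N != 2%N.
  by rewrite gtn_eqF// (leq_trans _ (leq_mul (leqnn 4) n_ge2)).
exists (real_gauge w w').
  by move=> z Zz; exact: (real_gauge_gauge qD qD' w_vol w'_vol wD w'D' Zz).
move=> s sT z Zz u uT.
exact: (dbar_real_gauge m_gt0 m_neq2 Q_bundle qD qD').
Qed.
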